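(* Let $P$ be a $d$-polytope with $n$ vertices, $m$ facets, $\alpha$ vertex-facet incidences, and $\varphi$ faces in total. (1) There is an algorithm that, given as input a vertex-facet incidence matrix of $P$, enumerates all faces of $P$ (each exactly once), each described by its vertex set and together with its dimension (but does not compute the edges of the Hasse diagram), in time $O(n\cdot\alpha\cdot\varphi)$, using space (without output space) $O(n^2\cdot d\cdot\log n)$ in addition to $O(\alpha\cdot\log\max\{n,m\})$ space for storing the incidences. (2) There is an algorithm for the same task with running time $O(\min\{n,m\}\cdot\alpha\cdot\varphi)$, obtained by applying the algorithm of part (1) to $P$ or to the dual polytope of $P$.
   Context: A $d$-polytope $P$ is a $d$-dimensional bounded convex polyhedron; its faces include $\varnothing$ (of dimension $-1$) and $P$ itself. Each face is identified with its set of vertices. A vertex-facet incidence matrix of $P$ is a matrix $A=(a_{fv})\in\{0,1\}^{m\times n}$, with rows indexed by the facets $F=\{1,\dots,m\}$ and columns by the vertices $V=\{1,\dots,n\}$, such that $a_{fv}=1$ if facet $f$ contains vertex $v$ and $a_{fv}=0$ otherwise; $\alpha$ is the number of ones in $A$. A vertex-facet incidence matrix of the dual polytope is the transpose of $A$. The incidences are stored in the sorted sparse format: for each vertex the increasingly sorted list of facets containing it, and for each facet the increasingly sorted list of vertices it contains. Running times refer to the uniform time measure (every arithmetic operation or comparison takes one unit of time); memory requirements refer to the bit model (number of bits). The constants in the $O$-notation are absolute, and $O(f)$ means at most a constant times $\max\{1,f\}$. *)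

(* Defs.v *)
From HB Require Import structures.
From mathcomp Require Import all_boot all_order all_algebra.
From mathcomp Require Import boolp classical_sets functions cardinality reals.
Set Implicit Arguments.
Unset Strict Implicit.
Unset Printing Implicit Defensive.
Import Order.TTheory GRing.Theory Num.Theory.

(* Random access machine programs in structured form. All values are natural
   numbers. A program works on finitely many registers and on finitely many
   unbounded arrays, reads its input from read-only arrays, and writes numbers
   one after the other on a write-only output tape. *)

Inductive binop := OAdd | OSub | OMul | OQuo | ORem | OEq | OLt.

Definition eval_op (o : binop) (a b : nat) : nat :=
  match o with
  | OAdd => a + b
  | OSub => a - b   (* truncated *)
  | OMul => a * b
  | OQuo => a %/ b
  | ORem => a %% b
  | OEq => a == b
  | OLt => a < b
  end.

Inductive expr :=
  | Cst of nat
  | Reg of nat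
  | Arr of nat & expr    (* Arr a e: entry number e of working array a *)
  | Inp of nat & expr    (* Inp a e: entry number e of input array a *)
  | Op of binop & expr & expr.

Inductive prog :=
  | Skip
  | SetReg of nat & expr
  | SetArr of nat & expr & expr   (* SetArr a e1 e2: a[e1] := e2 *)
  | Emit of expr
  | Seq of prog & prog
  | If of expr & prog & prog
  | While of expr & prog.

Record memory := Memory { regs : seq nat; arrs : seq (seq nat) }.

Definition mem0 : memory := Memory [::] [::].

Definition set_reg (s : memory) (x v : nat) : memory :=
  Memory (set_nth 0 (regs s) x v) (arrs s).

(* Writing at position i extends a shorter array by zeros up to position i,
   and all these cells count in the space of the memory. *)
Definition set_arr (s : memory) (a i v : nat) : memory :=
  Memory (regs s)
    (set_nth [::] (arrs s) a (set_nth 0 (nth [::] (arrs s) a) i v)).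

Fixpoint eval (inp : seq (seq nat)) (s : memory) (e : expr) : nat :=
  match e with
  | Cst c => c
  | Reg x => nth 0 (regs s) x
  | Arr a e1 => nth 0 (nth [::] (arrs s) a) (eval inp s e1)
  | Inp a e1 => nth 0 (nth [::] inp a) (eval inp s e1)
  | Op o e1 e2 => eval_op o (eval inp s e1) (eval inp s e2)
  end.

(* Uniform time measure: each access, operation and comparison takes one unit
   of time. *)
Fixpoint cost (e : expr) : nat :=
  match e with
  | Cst _ | Reg _ => 1
  | Arr _ e1 | Inp _ e1 => (cost e1).+1
  | Op _ e1 e2 => (cost e1 + cost e2).+1
  end.

(* Number of binary digits; 0 occupies one bit. *)
Definition nbits (v : nat) : nat := (trunc_log 2 v).+1.

Definition bits (l : seq nat) : nat := \sum_(v <- l) nbits v.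

Definition bits2 (ll : seq (seq nat)) : nat := \sum_(l <- ll) bits l.

(* The intermediate values of an expression are not counted: for a fixed
   expression their bits are within a constant factor of those of the memory
   and the input entries it reads. *)
Definition space (s : memory) : nat := bits (regs s) + bits2 (arrs s).

(* exec inp p s s' t b w: on input inp, the program p started in memory s halts
   in memory s' after t units of time; on the way the memory never occupies
   more than b bits (and b is attained), and w is written on the output tape. *)
Inductive exec (inp : seq (seq nat)) :
    prog -> memory -> memory -> nat -> nat -> seq nat -> Prop :=
  | ExecSkip s : exec inp Skip s s 1 (space s) [::]
  | ExecSetReg s x e :
      let s' := set_reg s x (eval inp s e) in
      exec inp (SetReg x e) s s' (cost e).+1 (maxn (space s) (space s')) [::]
  | ExecSetArr s a e1 e2 :
      let s' := set_arr s a (eval inp s e1) (eval inp s e2) in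
      exec inp (SetArr a e1 e2) s s' (cost e1 + cost e2).+1
        (maxn (space s) (space s')) [::]
  | ExecEmit s e :
      exec inp (Emit e) s s (cost e).+1 (space s) [:: eval inp s e]
  | ExecSeq p1 p2 s s1 s2 t1 t2 b1 b2 w1 w2 :
      exec inp p1 s s1 t1 b1 w1 -> exec inp p2 s1 s2 t2 b2 w2 ->
      exec inp (Seq p1 p2) s s2 (t1 + t2) (maxn b1 b2) (w1 ++ w2)
  | ExecIf e p1 p2 s s' t b w :
      exec inp (if eval inp s e != 0 then p1 else p2) s s' t b w ->
      exec inp (If e p1 p2) s s' ((cost e).+1 + t) b w
  | ExecWhileEnd e p s :
      eval inp s e = 0 ->
      exec inp (While e p) s s (cost e).+1 (space s) [::]
  | ExecWhileStep e p s s1 s2 t1 t2 b1 b2 w1 w2 :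
      eval inp s e != 0 ->
      exec inp p s s1 t1 b1 w1 -> exec inp (While e p) s1 s2 t2 b2 w2 ->
      exec inp (While e p) s s2 ((cost e).+1 + t1 + t2) (maxn b1 b2)
        (w1 ++ w2).

(* Neither the read-only input nor the output contributes to the space b. *)
Definition runs (p : prog) (inp : seq (seq nat)) (t b : nat) (w : seq nat) :
    Prop :=
  exists s', exec inp p mem0 s' t b w.

(* x is at most C times max {1, f} *)
Definition bounded_by (C f x : nat) : Prop := x <= C * maxn 1 f.

Section Polytopes.
Local Open Scope ring_scope.
Local Open Scope classical_set_scope.
Variables (R : realType) (k : nat).
Implicit Types (G P : set 'rV[R]_k) (x y : 'rV[R]_k).

Definition polyhedron P : Prop :=
  exists q (M : 'M[R]_(k, q)) (b : 'rV[R]_q),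
    P = [set x | forall j, (x *m M) 0 j <= b 0 j].

Definition bounded P : Prop :=
  exists B : R, forall x, P x -> forall j, `|x 0 j| <= B.

Definition aff_hull G : set 'rV[R]_k :=
  [set y | exists r (X : 'M[R]_(r, k)) (l : 'rV[R]_r),
     [/\ forall i, G (row i X), \sum_i l 0 i = 1 & y = l *m X]].

(* The affine hull of a nonempty G is x + U for a point x and a linear subspace
   U (the row space of a matrix), whose dimension is the dimension of G. For
   G empty there is no such x, and the default value -1 is returned. *)
Definition affdim G : int :=
  xget (-1) [set e : int | exists x (U : 'M[R]_k),
    aff_hull G = [set y | (y - x <= U)%MS] /\ e = (\rank U)%:Z].

Definition polytope (d : nat) P : Prop :=
  [/\ polyhedron P, bounded P & affdim P = d%:Z].

(* The inequalities 0 <= 1 and 0 <= 0 give the faces set0 and P. *)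
Definition faces P : set (set 'rV[R]_k) :=
  [set G | exists (c : 'cV[R]_k) (b : R),
     (forall x, P x -> (x *m c) 0 0 <= b) /\
     G = [set x | P x /\ (x *m c) 0 0 = b]].

Definition vertices P : set 'rV[R]_k := [set x | faces P [set x]].

Definition facets (d : nat) P : set (set 'rV[R]_k) :=
  [set G | faces P G /\ affdim G = d%:Z - 1].

(* v numbers the vertices and f the facets of the d-polytope P, and A is the
   vertex-facet incidence matrix for these numberings. *)
Definition vf_incidence (d : nat) P (n m : nat) (v : 'I_n -> 'rV[R]_k)
    (f : 'I_m -> set 'rV[R]_k) (A : 'M[bool]_(m, n)) : Prop :=
  [/\ set_bij setT (vertices P) v,
      set_bij setT (facets d P) f
    & forall i j, A i j <-> f i (v j)].

Definition vset (n : nat) (v : 'I_n -> 'rV[R]_k) G : {set 'I_n} :=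
  [set j | `[< G (v j) >]]%SET.

(* L lists the faces of P, each exactly once, as pairs of a vertex set and a
   dimension. *)
Definition enumerates P (n : nat) (v : 'I_n -> 'rV[R]_k)
    (L : seq ({set 'I_n} * int)) : Prop :=
  exists Gs : seq (set 'rV[R]_k),
    [/\ uniq Gs, forall G, G \in Gs <-> faces P G
      & L = [seq (vset v G, affdim G) | G <- Gs]].

End Polytopes.

Section Formats.
Variables (m n : nat).
Implicit Types (A : 'M[bool]_(m, n)) (L : seq ({set 'I_n} * int)).

Definition incidences A : nat := \sum_(i < m) \sum_(j < n) A i j.

(* For each row, the increasing list of the columns with a one in this row. *)
Definition row_lists A : seq (seq nat) :=
  [seq [seq val j | j <- enum 'I_n & A i j] | i <- enum 'I_m].

End Formats.

(* Starting positions of the lists of ll in flatten ll, followed by the size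
   of flatten ll. *)
Definition offsets (ll : seq (seq nat)) : seq nat :=
  0 :: scanl addn 0 (shape ll).

(* Sorted sparse format. Array 0 holds n and m. The lists of the vertices of
   the facets are concatenated in array 2, those of the facets of the vertices
   in array 4; arrays 1 and 3 tell where each list starts and ends. *)
Definition sparse (m n : nat) (A : 'M[bool]_(m, n)) : seq (seq nat) :=
  [:: [:: n; m];
      offsets (row_lists A); flatten (row_lists A);
      offsets (row_lists A^T%R); flatten (row_lists A^T%R)].

(* A face is written as its dimension plus 1 (a natural number, as the
   dimension is at least -1), its number of vertices, and its vertices in
   increasing order. *)
Definition encode (n : nat) (L : seq ({set 'I_n} * int)) : seq nat :=
  flatten [seq `|(p.2 + 1)%R|%N :: #|p.1| :: [seq val j | j <- enum p.1]
          | p : {set 'I_n} * int <- L].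

(* A face of the dual polytope is given by a set T of facets of P; the face of
   P corresponding to it is the intersection of the facets in T. *)
Definition dual_face (m n : nat) (A : 'M[bool]_(m, n)) (d : nat)
    (p : {set 'I_m} * int) : {set 'I_n} * int :=
  ([set j | [forall (i | i \in p.1), A i j]]%SET, (d%:Z - 1 - p.2)%R).

(* Main.v *)
(* Identify a face with its vertex set. The vertex sets of the faces are exactly
   the closed sets of the incidence matrix, where the closure of X is the
   intersection of the facets containing X. Closed sets are enumerated in lectic
   order without storing them: the successor of S is the closure of the elements
   of S below i together with i, for the largest i outside S for which this
   closure adds nothing below i; this takes one closure, O(alpha) time, per i.
   The dimension of a face is read off a saturated chain down to the empty face:
   intersect with a facet not containing the current face so that as many
   vertices as possible survive. The result is a facet of the current face, and
   its dimension is smaller by one.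

   If m < n, the closed sets of facets are enumerated in the same way, and each
   one is replaced by the set of vertices common to its facets. This one program
   needs time O(min{n, m} alpha phi) and arrays of size at most n with entries
   below 4^n times a constant, so it serves for both parts.

   On the geometric side, take an inequality system for P of minimal size. A
   nonempty face consists of the feasible points satisfying with equality all the
   inequalities active at a point of its relative interior, and its dimension is
   the dimension of the kernel of these inequalities. Moving along rays in such
   kernels shows that faces have vertices, that a face is determined by them, and
   that covers in the face lattice raise the dimension by one; minimality of the
   system yields enough facets. *)

Require Import Defs.
From HB Require Import structures.
From mathcomp Require Import all_boot all_order all_algebra.
From mathcomp Require Import boolp classical_sets functions cardinality reals.
From mathcomp Require Import finmap fintype finset zify lra.
(* Again, since [Defs.space] is shadowed by the library. *)
Require Import Defs.
Set Implicit Arguments.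
Unset Strict Implicit.
Unset Printing Implicit Defensive.

(** * Closed sets of an incidence matrix and their lectic order *)

(** One of the two derivation operators of the incidence relation. Applied to [B^T] it leads from
    rows back to columns, so one definition serves vertices and facets alike. *)
Definition polar (p q : nat) (B : 'M[bool]_(p, q)) (X : {set 'I_q}) : {set 'I_p} :=
  [set i | [forall (j | j \in X), B i j]].

Definition gclosure (p q : nat) (B : 'M[bool]_(p, q)) (X : {set 'I_q}) : {set 'I_q} :=
  polar B^T%R (polar B X).

Section Polar.
Variables (p q : nat) (B : 'M[bool]_(p, q)).
Implicit Types (X Y : {set 'I_q}) (T : {set 'I_p}).

Lemma polarP i X : reflect (forall j, j \in X -> B i j) (i \in polar B X).
Proof. by rewrite inE; apply: (iffP forall_inP). Qed.

Lemma mem_gclosure j X :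
  reflect (forall i, (forall l, l \in X -> B i l) -> B i j) (j \in gclosure B X).
Proof.
rewrite inE; apply: (iffP forall_inP) => h i; first by move=> /polarP /h; rewrite mxE.
by rewrite mxE => /polarP; apply: h.
Qed.

Lemma sub_gclosure X : X \subset gclosure B X.
Proof. by apply/subsetP => j jX; apply/mem_gclosure => i; apply. Qed.

Lemma gclosureS X Y : X \subset Y -> gclosure B X \subset gclosure B Y.
Proof.
move=> /subsetP sXY; apply/subsetP => j /mem_gclosure h.
by apply/mem_gclosure => i hi; apply: h => l /sXY; apply: hi.
Qed.

(** Triple identity of the Galois connection; idempotence of the closure follows from it. *)
Lemma polar_gclosure X : polar B (gclosure B X) = polar B X.
Proof.
apply/setP => i; apply/polarP/polarP => h j jX.
  by apply: h; apply: (subsetP (sub_gclosure X)).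
by move/mem_gclosure: jX; apply.
Qed.

Lemma gclosure_id X : gclosure B (gclosure B X) = gclosure B X.
Proof. by rewrite {1}/gclosure polar_gclosure. Qed.

End Polar.

Lemma gclosure_polar p q (B : 'M[bool]_(p, q)) (T : {set 'I_p}) :
  gclosure B (polar B^T%R T) = polar B^T%R T.
Proof.
have := @polar_gclosure _ _ B^T%R T; rewrite /gclosure.
by rewrite trmxK.
Qed.

Section Lectic.
Variables (p q : nat) (B : 'M[bool]_(p, q)).
Implicit Types (X Y S : {set 'I_q}).

(** Lexicographic comparison of characteristic words read from the smallest index, with absence
    before presence; [i] is the position of the first difference. *)
Definition lectic_at (i : 'I_q) X Y : bool :=
  [&& i \notin X, i \in Y & [forall (j : 'I_q | j < i), (j \in X) == (j \in Y)]].

Definition lectic X Y : bool := [exists i, lectic_at i X Y].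

Lemma lectic_atP i X Y :
  reflect [/\ i \notin X, i \in Y & forall j : 'I_q, j < i -> (j \in X) = (j \in Y)]
    (lectic_at i X Y).
Proof.
apply: (iffP and3P) => -[-> -> h]; split=> //.
  by move=> j ji; apply/eqP; move/forall_inP: h; apply.
by apply/forall_inP => j ji; apply/eqP/h.
Qed.

Lemma lectic_irr X : lectic X X = false.
Proof. by apply/existsP => -[i /lectic_atP[/negP]]. Qed.

Lemma lectic_trans Y X Z : lectic X Y -> lectic Y Z -> lectic X Z.
Proof.
move=> /existsP[i /lectic_atP[iX iY hi]] /existsP[j /lectic_atP[jY jZ hj]].
apply/existsP; case: (ltngtP i j) => ij.
- exists i; apply/lectic_atP; split=> // [|l li]; first by rewrite -hj.
  by rewrite hi // hj // (ltn_trans li).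
- exists j; apply/lectic_atP; split=> // [|l li]; first by rewrite hi.
  by rewrite hi ?hj // (ltn_trans li).
- by move/val_inj: ij jY => <-; rewrite iY.
Qed.

Lemma lectic_proper X Y : X \proper Y -> lectic X Y.
Proof.
move=> /properP[/subsetP sXY [j0 j0Y j0X]].
pose D j := (j \in Y) && (j \notin X).
have D0 : D j0 by rewrite /D j0Y.
case: (arg_minnP val D0) => k /andP[kY kX] hk.
apply/existsP; exists k; apply/lectic_atP; split=> // l lk.
apply/idP/idP => [/sXY //|lY]; apply/negPn/negP => lX.
by have := hk l; rewrite /D lY lX leqNgt lk => /(_ isT).
Qed.

(** The basic operation of Ganter's NextClosure algorithm. *)
Definition candidate S (i : nat) : {set 'I_q} :=
  gclosure B [set j : 'I_q | (j < i) && (j \in S) || (val j == i)].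

Definition good S (i : 'I_q) : bool :=
  (i \notin S) && [forall (j : 'I_q | j < i), (j \in candidate S i) ==> (j \in S)].

Lemma good_lectic S i : good S i -> lectic_at i S (candidate S i).
Proof.
move=> /andP[iS /forall_inP h]; apply/lectic_atP; split=> //.
  by apply: (subsetP (sub_gclosure _ _)); rewrite inE eqxx orbT.
move=> j ji; apply/idP/idP => jS; last by apply: (implyP (h _ ji)).
by apply: (subsetP (sub_gclosure _ _)); rewrite inE ji jS.
Qed.

(** At the first difference [i] of [S] and [X], the generators of the candidate all lie in the
    closed set [X], hence so does the candidate. As [X] agrees with [S] below [i], the candidate
    adds nothing there. *)
Lemma lectic_good S X : gclosure B X = X -> lectic S X ->
  exists2 i, good S i & lectic_at i S X /\ candidate S i \subset X.
Proof.
move=> cX /existsP[i iSX]; case/lectic_atP: (iSX) => iS iX h.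
have sX : candidate S i \subset X.
  rewrite -cX; apply: gclosureS; apply/subsetP => j; rewrite inE.
  by case/orP=> [/andP[/h-> //]|/eqP/val_inj ->].
exists i => //; apply/andP; split=> //; apply/forall_inP => j ji; apply/implyP.
by move=> /(subsetP sX); rewrite h.
Qed.

(** The first difference [j] of [S] and [X] is good, so [j <= i]. If [j = i], the candidate is
    contained in [X]. If [j < i], the candidate at [i] still agrees with [S] up to and including
    [j], so [j] is also its first difference from [X]. *)
Lemma next_closed S i X : good S i -> (forall j, good S j -> j <= i) ->
  gclosure B X = X -> lectic S X -> X = candidate S i \/ lectic (candidate S i) X.
Proof.
move=> gi hmax cX /(lectic_good cX)[j gj [jSX sX]].
case/lectic_atP: jSX => jS jX hj; have /lectic_atP[iS iC hi] := good_lectic gi.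
have := hmax _ gj; rewrite leq_eqVlt => /orP[/eqP/val_inj ij|ji].
  rewrite -{}ij in iS iC hi *; case: (eqVneq (candidate S j) X) => [->|nX]; first by left.
  by right; apply: lectic_proper; rewrite properEneq nX.
right; apply/existsP; exists j; apply/lectic_atP; split=> //; first by rewrite -hi.
by move=> l lj; rewrite -hi ?hj // (ltn_trans lj).
Qed.

(** The closed sets still to be listed after [S]; their number is the termination measure of the
    enumeration. *)
Definition above S : {set {set 'I_q}} := [set X | (gclosure B X == X) && lectic S X].

Lemma above_next S i : good S i -> (forall j, good S j -> j <= i) ->
  above S = candidate S i |: above (candidate S i).
Proof.
move=> gi hmax; have SC : lectic S (candidate S i).
  by apply/existsP; exists i; apply: good_lectic.
apply/setP => X; rewrite !inE; apply/andP/idP => [[/eqP cX SX]|/orP[/eqP ->|/andP[-> CX]]].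
- by have [->|->] := next_closed gi hmax cX SX; rewrite ?eqxx // cX eqxx orbT.
- by rewrite {1}/candidate gclosure_id eqxx.
- by split=> //; apply: lectic_trans CX.
Qed.

Lemma above_last S : (forall i, ~~ good S i) -> above S = set0.
Proof.
move=> h; apply/setP => X; rewrite !inE; apply/negbTE/negP => /andP[/eqP cX].
by move=> /(lectic_good cX)[i]; rewrite (negbTE (h i)).
Qed.

Lemma notin_above S : S \notin above S.
Proof. by rewrite inE lectic_irr andbF. Qed.

Lemma above0 X : gclosure B X = X -> X \in set0 |: above set0.
Proof.
move=> cX; rewrite !inE cX eqxx; case: eqP => //= /eqP X0.
by apply: lectic_proper; rewrite properEneq eq_sym X0 sub0set.
Qed.

End Lectic.

(* The rank is the dimension plus one. *)
Record face_lattice (d n m : nat) (A : 'M[bool]_(m, n)) (rho : {set 'I_n} -> nat) : Prop :=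
  FaceLattice {
    lattice_bot : gclosure A set0 = set0;
    lattice_top : polar A setT = set0;
    lattice_atom : forall j, gclosure A [set j] = [set j];
    facet_nonempty : 0 < d -> forall i, exists j, A i j;
    lattice_rows : forall i i', (forall j, A i j = A i' j) -> i = i';
    rank_bot : rho set0 = 0;
    rank_top : rho setT = d.+1;
    rank_cover : forall X Y : {set 'I_n}, gclosure A X = X -> gclosure A Y = Y -> X \proper Y ->
      (forall Z, gclosure A Z = Z -> X \proper Z -> ~~ (Z \proper Y)) -> rho Y = (rho X).+1 }.

(** * Consequences of the lattice axioms for ranks and for the numbers of vertices and facets *)

Section RankBounds.
Variables (d n m : nat) (A : 'M[bool]_(m, n)) (rho : {set 'I_n} -> nat).
Hypothesis FL : face_lattice d A rho.
Implicit Types (X Y Z : {set 'I_n}).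

Lemma gclosureT : gclosure A setT = setT.
Proof. by apply/eqP; rewrite eqEsubset subsetT sub_gclosure. Qed.

(** Among the closed sets containing [X] and properly contained in [Y], one of maximal cardinality
    is a lower cover of [Y], to which the cover axiom applies. *)
Lemma cover_below X Y : gclosure A X = X -> gclosure A Y = Y -> X \proper Y ->
  exists Z, [/\ gclosure A Z = Z, X \subset Z, Z \proper Y & rho Y = (rho Z).+1].
Proof.
move=> cX cY XY; pose D Z := [&& gclosure A Z == Z, X \subset Z & Z \proper Y].
have DX : D X by rewrite /D cX eqxx subxx.
case: (arg_maxnP (fun Z : {set 'I_n} => #|Z|) DX) => Z /and3P[/eqP cZ XZ ZY] hmax.
exists Z; split=> //; apply: (rank_cover FL) => // W cW ZW; apply/negP => WY.
have := hmax W; rewrite /D cW eqxx (subset_trans XZ (proper_sub ZW)) WY => /(_ isT) /=; apply/negP.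
by rewrite -ltnNge proper_card.
Qed.

Lemma cover_above X Y : gclosure A X = X -> gclosure A Y = Y -> X \proper Y ->
  exists Z, [/\ gclosure A Z = Z, X \proper Z, Z \subset Y & rho Z = (rho X).+1].
Proof.
move=> cX cY XY; pose D Z := [&& gclosure A Z == Z, X \proper Z & Z \subset Y].
have DY : D Y by rewrite /D cY eqxx XY subxx.
case: (arg_minnP (fun Z : {set 'I_n} => #|Z|) DY) => Z /and3P[/eqP cZ XZ ZY] hmin.
exists Z; split=> //; apply: (rank_cover FL) => // W cW XW; apply/negP => WZ.
have := hmin W; rewrite /D cW eqxx XW (subset_trans (proper_sub WZ) ZY) => /(_ isT) /=; apply/negP.
by rewrite -ltnNge proper_card.
Qed.

(** Going down through lower covers, each step lowers the rank by exactly one and loses at least one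
    vertex. *)
Lemma rank_le_card X : gclosure A X = X -> rho X <= #|X|.
Proof.
have [r] := ubnP #|X|; elim: r X => // r IH X hr cX.
case: (eqVneq X set0) => [->|X0]; first by rewrite (rank_bot FL).
have [|Z [cZ _ ZX ->]] := cover_below (lattice_bot FL) cX.
  by rewrite properEneq eq_sym X0 sub0set.
have ltZ := proper_card ZX; apply: (leq_ltn_trans _ ltZ); apply: IH => //; exact: leq_trans ltZ hr.
Qed.

(** Going up through upper covers, each step raises the rank by exactly one and loses at least one
    common facet, since distinct closed sets have distinct polars. *)
Lemma rank_corank X : gclosure A X = X -> rho X <= d.+1 /\ d.+1 <= rho X + #|polar A X|.
Proof.
have [r] := ubnP #|polar A X|; elim: r X => // r IH X hr cX.
case: (eqVneq X setT) => [->|XT]; first by rewrite (rank_top FL) leqnn leq_addr.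
have [|Z [cZ XZ _ rZ]] := cover_above cX gclosureT; first by rewrite properEneq XT subsetT.
have ltZ : #|polar A Z| < #|polar A X|.
  apply: proper_card; rewrite properEneq; apply/andP; split.
    by apply/eqP => E; move: XZ; rewrite -cX -cZ /gclosure E properxx.
  by apply/subsetP => i /polarP h; apply/polarP => j jX; apply: h; apply: (subsetP (proper_sub XZ)).
have [] := IH Z (leq_trans ltZ hr) cZ; rewrite rZ => h1 h2; split; first exact: ltnW.
by apply: leq_trans h2 _; rewrite addSnnS leq_add2l.
Qed.

Lemma dim_lt_vertices : d < n.
Proof. by have := rank_le_card gclosureT; rewrite (rank_top FL) cardsT card_ord. Qed.

Lemma dim_lt_facets : d < m.
Proof.
have [_] := rank_corank (lattice_bot FL); rewrite (rank_bot FL) add0n.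
by move/leq_trans; apply; rewrite -[leqRHS]card_ord max_card.
Qed.

Lemma rank_mono X Y : gclosure A X = X -> gclosure A Y = Y -> X \proper Y -> rho X < rho Y.
Proof.
move=> cX; have [r] := ubnP #|Y|; elim: r Y => // r IH Y hr cY XY.
have [Z [cZ XZ ZY ->]] := cover_below cX cY XY; rewrite ltnS.
case: (eqVneq X Z) => [->//|nXZ]; apply/ltnW/IH => //; last by rewrite properEneq nXZ.
exact: leq_trans (proper_card ZY) hr.
Qed.

(** With two vertices, the empty set, a single vertex and the whole set would form a chain and force
    the top rank to be at least 2, whereas it is 1. *)
Lemma dim0_vertices : d = 0 -> n = 1.
Proof.
move=> d0; apply/eqP; rewrite eqn_leq (leq_ltn_trans _ dim_lt_vertices) // andbT leqNgt.
apply/negP => n2; pose j := Ordinal (ltnW n2).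
have h1 : rho set0 < rho [set j].
  apply: rank_mono; rewrite ?(lattice_bot FL) ?(lattice_atom FL) //.
  by rewrite properEcard sub0set cards0 cards1.
have h2 : rho [set j] < rho setT.
  apply: rank_mono; rewrite ?gclosureT ?(lattice_atom FL) //.
  by rewrite properEcard subsetT cards1 cardsT card_ord.
by move: h1 h2; rewrite (rank_bot FL) (rank_top FL) d0; lia.
Qed.

(** Facets are told apart by their vertex sets. The crude bound is what makes the bit length of
    every counter linear in [n]. *)
Lemma facets_le_exp : m <= 2 ^ n.
Proof.
pose g (i : 'I_m) : {set 'I_n} := [set j | A i j].
have gI : injective g.
  by move=> i i' /setP E; apply: (lattice_rows FL) => j; have := E j; rewrite !inE.
have := leq_card g gI; rewrite card_ord => /leq_trans; apply.
by rewrite -cardsT -powersetT card_powerset cardsT card_ord.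
Qed.

(** The closure of a vertex lying in no facet would be the whole set, but singletons are closed and
    [d < n] leaves more than one vertex. *)
Lemma vertex_in_facet : 0 < d -> forall j, exists i, A i j.
Proof.
move=> d0 j; case: (pickP (fun i => A i j)) => [i Aij|h]; first by exists i.
have : gclosure A [set j] = setT.
  apply/setP => l; rewrite in_setT; apply/mem_gclosure => i /(_ j).
  by rewrite inE eqxx h => /(_ isT).
rewrite (lattice_atom FL) => /(congr1 (fun X : {set 'I_n} => #|X|)).
by rewrite cards1 cardsT card_ord; have := dim_lt_vertices; lia.
Qed.

(** The two polar maps are inverse bijections between the closed sets of the two sides. Hence
    enumerating facet sets and replacing each by its common vertices lists every closed vertex set
    once. *)
Lemma polar_bij_closed (l : seq {set 'I_m}) :
    uniq l -> (forall T, T \in l = (gclosure A^T%R T == T)) ->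
  uniq (map (polar A^T%R) l) /\
  forall X, X \in map (polar A^T%R) l = (gclosure A X == X).
Proof.
have cT T : gclosure A^T%R T = polar A (polar A^T%R T) by rewrite /gclosure trmxK.
move=> ul hl; split.
  rewrite map_inj_in_uniq // => T T'; rewrite !hl !cT => /eqP {2}<- /eqP {2}<- ->.
  by [].
move=> X; apply/mapP/eqP => [[T _ ->]|cX]; first exact: gclosure_polar.
by exists (polar A X); rewrite ?hl ?cT -/(gclosure A X) cX.
Qed.

Lemma card_closed_tr :
  #|[set T | gclosure A^T%R T == T]| = #|[set X | gclosure A X == X]|.
Proof.
have [||ul hl] := @polar_bij_closed (enum [set T | gclosure A^T%R T == T]).
- exact: enum_uniq.
- by move=> T; rewrite mem_enum inE.
rewrite cardE -(size_map (polar A^T%R)) -(card_uniqP ul).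
by apply: eq_card => X; rewrite hl inE.
Qed.

End RankBounds.

(** * A program logic with time and space bounds *)

Definition rg (s : memory) (x : nat) : nat := nth 0 (regs s) x.
Definition ar (s : memory) (a i : nat) : nat := nth 0 (nth [::] (arrs s) a) i.
Definition ip (inp : seq (seq nat)) (a i : nat) : nat := nth 0 (nth [::] inp a) i.

Lemma rg_set_reg s x v y : rg (set_reg s x v) y = if y == x then v else rg s y.
Proof. by rewrite /rg nth_set_nth. Qed.

Lemma ar_set_reg s x v a i : ar (set_reg s x v) a i = ar s a i.
Proof. by []. Qed.

Lemma rg_set_arr s a i v x : rg (set_arr s a i v) x = rg s x.
Proof. by []. Qed.

Lemma ar_set_arr s a i v a' i' :
  ar (set_arr s a i v) a' i' = if (a' == a) && (i' == i) then v else ar s a' i'.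
Proof.
by rewrite /ar /= nth_set_nth /=; case: eqP => //= ->; rewrite nth_set_nth.
Qed.

Definition memE := (rg_set_reg, ar_set_reg, rg_set_arr, ar_set_arr).

(** The same semantics as [eval], phrased with accessors that [simpl] does not unfold, so that
    simplifying a goal stops at [rg], [ar] and [ip]. *)
Fixpoint ev (inp : seq (seq nat)) (s : memory) (e : expr) : nat :=
  match e with
  | Cst c => c
  | Reg x => rg s x
  | Arr a e1 => ar s a (ev inp s e1)
  | Inp a e1 => ip inp a (ev inp s e1)
  | Op o e1 e2 => eval_op o (ev inp s e1) (ev inp s e2)
  end.

Arguments rg : simpl never.
Arguments ar : simpl never.
Arguments ip : simpl never.

Lemma evalE inp s e : eval inp s e = ev inp s e.
Proof. by elim: e => //= [a e -> //|a e -> //|o e1 -> e2 ->]. Qed.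

(* Register 12 and array 5 are the last ones that the programs below use. *)
Definition num_regs := 13.
Definition num_arrs := 6.

Section Space.
Variables L V : nat.

(** The invariant behind all space bounds: limiting the number of cells and the size of each value
    makes [space_bound] valid at every moment, so that no rule has to add up bits. *)
Definition ok (s : memory) : bool :=
  [&& size (regs s) <= num_regs, all (leq^~ V) (regs s), size (arrs s) <= num_arrs
    & all (fun l => (size l <= L) && all (leq^~ V) l) (arrs s)].

Definition space_bound := (num_regs + num_arrs * L) * nbits V.

Lemma nbits_leq a b : a <= b -> nbits a <= nbits b.
Proof. by move=> ab; rewrite /nbits ltnS leq_trunc_log. Qed.

Lemma bits_leq l : all (leq^~ V) l -> bits l <= size l * nbits V.
Proof.
rewrite /bits; elim: l => [|x l IH] /=; first by rewrite big_nil.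
move=> /andP[xV /IH h]; rewrite big_cons mulSn leq_add // nbits_leq //.
Qed.

Lemma ok_space s : ok s -> space s <= space_bound.
Proof.
move=> /and4P[h1 h2 h3 h4]; rewrite /space /space_bound mulnDl leq_add //.
  by rewrite (leq_trans (bits_leq h2)) // leq_mul2r h1 orbT.
have : bits2 (arrs s) <= size (arrs s) * (L * nbits V).
  rewrite /bits2; elim: (arrs s) h4 => [|l ll IH] /=; first by rewrite big_nil.
  move=> /andP[/andP[lL lV] /IH h]; rewrite big_cons mulSn leq_add //.
  by rewrite (leq_trans (bits_leq lV)) // leq_mul2r lL orbT.
by move/leq_trans; apply; rewrite -mulnA leq_mul2r h3 orbT.
Qed.

Lemma ok_mem0 : ok mem0. Proof. by []. Qed.

Lemma ok_rg s x : ok s -> rg s x <= V.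
Proof.
move=> /and4P[_ h _ _]; rewrite /rg; case: (ltnP x (size (regs s))) => hx.
  by rewrite (allP h) ?mem_nth.
by rewrite nth_default.
Qed.

Lemma ok_ar s a i : ok s -> ar s a i <= V.
Proof.
move=> /and4P[_ _ _ /allP h]; rewrite /ar.
case: (ltnP a (size (arrs s))) => ha; last by rewrite (nth_default [::]) // nth_nil.
have /andP[_ /allP h'] := h _ (mem_nth [::] ha).
by case: (ltnP i (size (nth [::] (arrs s) a))) => hi; [apply/h'/mem_nth|rewrite nth_default].
Qed.

Lemma all_set_nth (T : Type) (p : pred T) x0 (s : seq T) i x :
  p x0 -> p x -> all p s -> all p (set_nth x0 s i x).
Proof.
move=> p0 px; elim: s i => [|y s IH] [|i] /=; rewrite ?px ?p0 //.
- by move=> _; elim: i => [|i IH] /=; rewrite ?px ?p0.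
- by move=> /andP[].
- by move=> /andP[-> /IH ->].
Qed.

Lemma ok_set_reg s x v : ok s -> x < num_regs -> v <= V -> ok (set_reg s x v).
Proof.
move=> /and4P[h1 h2 h3 h4] hx hv; apply/and4P; split=> //=.
  by rewrite size_set_nth geq_max hx.
exact: all_set_nth.
Qed.

Lemma ok_set_arr s a i v : ok s -> a < num_arrs -> i < L -> v <= V -> ok (set_arr s a i v).
Proof.
move=> /and4P[h1 h2 h3 h4] ha hi hv; apply/and4P; split=> //=.
  by rewrite size_set_nth geq_max ha.
have /andP[h5 h6] : (size (nth [::] (arrs s) a) <= L) && all (leq^~ V) (nth [::] (arrs s) a).
  case: (ltnP a (size (arrs s))) => hx; last by rewrite nth_default.
  by move/allP: h4; apply; rewrite mem_nth.
apply: all_set_nth => //; rewrite size_set_nth geq_max hi h5 /=.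
exact: all_set_nth.
Qed.

End Space.

(** Frame condition of the logic. Arrays are compared through their entries, so padding by zeros is
    invisible. *)
Definition same (rs ass : seq nat) (s s' : memory) : Prop :=
  (forall x, x \notin rs -> rg s' x = rg s x) /\
  (forall a, a \notin ass -> forall i, ar s' a i = ar s a i).

Lemma same_trans rs ass s1 s2 s3 : same rs ass s1 s2 -> same rs ass s2 s3 -> same rs ass s1 s3.
Proof.
by move=> [h1 h2] [h3 h4]; split=> [x hx|a ha i]; [rewrite h3 ?h1|rewrite h4 ?h2].
Qed.

Lemma same_sub rs ass rs' ass' s s' : {subset rs <= rs'} -> {subset ass <= ass'} ->
  same rs ass s s' -> same rs' ass' s s'.
Proof.
move=> h h' [h1 h2]; split=> [x hx|a ha i]; first by rewrite h1 //; apply: contra hx; apply: h.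
by rewrite h2 //; apply: contra ha; apply: h'.
Qed.

Lemma same_set_reg rs ass s s' x v : x \in rs -> same rs ass s s' -> same rs ass s (set_reg s' x v).
Proof.
move=> hx [h1 h2]; split=> [y hy|a ha i]; rewrite memE ?h1 ?h2 //.
by case: eqP hy hx => // -> /negbTE->.
Qed.

Lemma same_set_arr rs ass s s' a i v : a \in ass -> same rs ass s s' -> same rs ass s (set_arr s' a i v).
Proof.
move=> hx [h1 h2]; split=> [y hy|a' ha i']; rewrite memE ?h1 ?h2 //.
by case: eqP ha hx => //= -> /negbTE->.
Qed.

(** Frames are read off the syntax, so that side conditions about unmodified registers and arrays
    are settled by computation. *)
Fixpoint rmods p : seq nat :=
  match p with
  | SetReg x _ => [:: x]
  | Seq p1 p2 | If _ p1 p2 => rmods p1 ++ rmods p2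
  | While _ p1 => rmods p1
  | _ => [::]
  end.

Fixpoint amods p : seq nat :=
  match p with
  | SetArr a _ _ => [:: a]
  | Seq p1 p2 | If _ p1 p2 => amods p1 ++ amods p2
  | While _ p1 => amods p1
  | _ => [::]
  end.

Lemma exec_same inp p s s' t b w : exec inp p s s' t b w -> same (rmods p) (amods p) s s'.
Proof.
elim=> {p s s' t b w} //=.
- by move=> s x e; apply: same_set_reg; rewrite ?inE.
- by move=> s a e1 e2; apply: same_set_arr; rewrite ?inE.
- move=> p1 p2 s s1 s2 *; apply: (@same_trans _ _ _ s1);
    by apply: same_sub; eauto => x; rewrite mem_cat => ->; rewrite ?orbT.
- by move=> e p1 p2 s s' t b w _; case: ifP => _; apply: same_sub => x; rewrite mem_cat => ->; rewrite ?orbT.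
- by move=> e p s s1 s2 *; apply: (@same_trans _ _ _ s1).
Qed.

(** The upper bound [hi] is evaluated anew at every test; the rules for loops therefore ask that its
    value stay constant. *)
Definition For r lo hi p :=
  Seq (SetReg r lo)
    (While (Op OLt (Reg r) hi) (Seq p (SetReg r (Op OAdd (Reg r) (Cst 1))))).

Definition Sum r x lo hi e :=
  Seq (SetReg x (Cst 0)) (For r lo hi (SetReg x (Op OAdd (Reg x) e))).

Arguments set_reg : simpl never.
Arguments set_arr : simpl never.

Section Logic.
Variables (inp : seq (seq nat)) (L V : nat).
Local Notation ok := (ok L V).
Local Notation ev := (ev inp).
Implicit Types (p : prog) (s : memory) (e : expr) (Q : memory -> seq nat -> Prop).

(** A triple for total correctness with resources. Time enters as an upper bound, so that costs may
    be rounded up to convenient multiples, and [ok] of the final memory is part of the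
    conclusion. *)
Definition tr p s T Q : Prop := exists s' t b w,
  [/\ exec inp p s s' t b w, t <= T, b <= space_bound L V, ok s' & Q s' w].

Lemma tr_weaken p s T T' Q Q' : tr p s T Q -> T <= T' ->
  (forall s' w, ok s' -> same (rmods p) (amods p) s s' -> Q s' w -> Q' s' w) -> tr p s T' Q'.
Proof.
move=> [s' [t [b [w [h1 h2 h3 h4 h5]]]]] hT hQ; exists s', t, b, w; split=> //.
  exact: leq_trans hT.
apply: hQ => //; exact: exec_same h1.
Qed.

Lemma tr_skip s Q : ok s -> Q s [::] -> tr Skip s 1 Q.
Proof.
by move=> oks q; exists s, 1, (space s), [::]; split=> //; [constructor|apply: ok_space].
Qed.

Lemma tr_set s x e Q : ok s -> x < num_regs -> ev s e <= V ->
  Q (set_reg s x (ev s e)) [::] -> tr (SetReg x e) s (cost e).+1 Q.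
Proof.
move=> oks hx hv q; have ok' := ok_set_reg oks hx hv.
have := ExecSetReg inp s x e; rewrite evalE /= => h.
eexists _, _, _, _; split; [exact: h|by []| |exact: ok'|exact: q].
by rewrite geq_max !ok_space.
Qed.

Lemma tr_arr s a e1 e2 Q : ok s -> a < num_arrs -> ev s e1 < L -> ev s e2 <= V ->
  Q (set_arr s a (ev s e1) (ev s e2)) [::] -> tr (SetArr a e1 e2) s (cost e1 + cost e2).+1 Q.
Proof.
move=> oks ha hi hv q; have ok' := ok_set_arr oks ha hi hv.
have := ExecSetArr inp s a e1 e2; rewrite !evalE /= => h.
eexists _, _, _, _; split; [exact: h|by []| |exact: ok'|exact: q].
by rewrite geq_max !ok_space.
Qed.

Lemma tr_emit s e Q : ok s -> Q s [:: ev s e] -> tr (Emit e) s (cost e).+1 Q.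
Proof.
move=> oks q; have := ExecEmit inp s e; rewrite evalE => h.
eexists _, _, _, _; split; [exact: h|by []| |by []|exact: q].
exact: ok_space.
Qed.

Lemma tr_seq p1 p2 s T1 T2 Q1 Q : tr p1 s T1 Q1 ->
  (forall s1 w1, ok s1 -> same (rmods p1) (amods p1) s s1 -> Q1 s1 w1 ->
     tr p2 s1 T2 (fun s2 w2 => Q s2 (w1 ++ w2))) ->
  tr (Seq p1 p2) s (T1 + T2) Q.
Proof.
move=> [s1 [t1 [b1 [w1 [h1 h2 h3 h4 h5]]]]] h.
have [s2 [t2 [b2 [w2 [h1' h2' h3' h4' h5']]]]] := h _ _ h4 (exec_same h1) h5.
exists s2, (t1 + t2), (maxn b1 b2), (w1 ++ w2); split=> //.
- exact: ExecSeq h1 h1'.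
- exact: leq_add.
- by rewrite geq_max h3.
Qed.

Lemma tr_if e p1 p2 s T Q :
  tr (if ev s e != 0 then p1 else p2) s T Q -> tr (If e p1 p2) s ((cost e).+1 + T) Q.
Proof.
move=> [s' [t [b [w [h1 h2 h3 h4 h5]]]]]; exists s', ((cost e).+1 + t), b, w; split=> //.
  by apply: ExecIf; rewrite evalE.
by rewrite leq_add2l.
Qed.

Lemma tr_while_end e p s Q : ok s -> ev s e = 0 -> Q s [::] -> tr (While e p) s (cost e).+1 Q.
Proof.
move=> oks e0 q; exists s, (cost e).+1, (space s), [::]; split=> //; last exact: ok_space.
by apply: ExecWhileEnd; rewrite evalE.
Qed.

Lemma tr_while_step e p s T1 T2 Q1 Q : ev s e != 0 -> tr p s T1 Q1 ->
  (forall s1 w1, ok s1 -> same (rmods p) (amods p) s s1 -> Q1 s1 w1 ->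
     tr (While e p) s1 T2 (fun s2 w2 => Q s2 (w1 ++ w2))) ->
  tr (While e p) s ((cost e).+1 + T1 + T2) Q.
Proof.
move=> e0 [s1 [t1 [b1 [w1 [h1 h2 h3 h4 h5]]]]] h.
have [s2 [t2 [b2 [w2 [h1' h2' h3' h4' h5']]]]] := h _ _ h4 (exec_same h1) h5.
exists s2, ((cost e).+1 + t1 + t2), (maxn b1 b2), (w1 ++ w2); split=> //.
- by apply: ExecWhileStep h1 h1'; rewrite evalE.
- by rewrite leq_add // leq_add2l.
- by rewrite geq_max h3.
Qed.

(** The invariant [I] speaks of the counter, the memory and the output written so far. Besides its
    body, a round costs [cost hi + 3] for the test and 4 for the increment; the initialisation and
    the failing last test account for [cost lo + cost hi + 4]. *)
Lemma tr_for r lo hi p s l h (T : nat -> nat) (I : nat -> memory -> seq nat -> Prop) :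
    ok s -> r < num_regs -> h <= V -> ev s lo = l -> l <= h ->
    (forall s', same (r :: rmods p) (amods p) s s' -> ev s' hi = h) ->
    r \notin rmods p ->
    I l (set_reg s r l) [::] ->
    (forall i s' w, l <= i < h -> ok s' -> same (r :: rmods p) (amods p) s s' -> rg s' r = i ->
       I i s' w -> tr p s' (T i) (fun s'' w' => I i.+1 (set_reg s'' r i.+1) (w ++ w'))) ->
  tr (For r lo hi p) s (cost lo + cost hi + 4 + \sum_(l <= i < h) (T i + (cost hi + 7)))
    (fun s' w => rg s' r = h /\ I h s' w).
Proof.
move=> oks hr hV elo lh ehi rp I0 step.
have key i s' w : l <= i <= h -> ok s' -> same (r :: rmods p) (amods p) s s' -> rg s' r = i ->
   I i s' w -> tr (While (Op OLt (Reg r) hi) (Seq p (SetReg r (Op OAdd (Reg r) (Cst 1))))) s'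
     (cost hi + 3 + \sum_(i <= j < h) (T j + (cost hi + 7)))
     (fun s'' w' => rg s'' r = h /\ I h s'' (w ++ w')).
  move=> /andP[li ih]; elim: {i}(h - i) {-2}i (erefl (h - i)) li ih s' w => [|d IH] i hd li ih s' w oks' fr ri Ii.
    have {ih hd} ih : i = h by lia.
    apply: (@tr_weaken _ _ (cost (Op OLt (Reg r) hi)).+1 _ (fun s'' w' => rg s'' r = h /\ I h s'' (w ++ w'))) => //=.
    - apply: tr_while_end => //=; first by rewrite ri ehi // ih ltnn.
      by rewrite cats0 ri -{2}ih.
    - lia.
  have {}ih : i < h by lia.
  rewrite big_ltn //.
  apply: (@tr_weaken _ _ ((cost (Op OLt (Reg r) hi)).+1 + (T i + 4) +
     (cost hi + 3 + \sum_(i.+1 <= j < h) (T j + (cost hi + 7)))) _ (fun s'' w' => rg s'' r = h /\ I h s'' (w ++ w'))) => //.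
  - apply: (@tr_while_step _ _ _ _ _ (fun s'' w' => [/\ ok s'', same (r :: rmods p) (amods p) s s'',
        rg s'' r = i.+1 & I i.+1 s'' (w ++ w')])).
    + by rewrite /= ri ehi // ih.
    + apply: tr_seq; first by apply: (step i s' w) => //; rewrite li.
      move=> s1 w1 ok1 fr1 I1; apply: tr_set => //=.
        rewrite (_ : rg s1 r = i) ?addn1; first by rewrite (leq_trans ih).
        by rewrite fr1.1.
      have -> : rg s1 r + 1 = i.+1 by rewrite fr1.1 // ri addn1.
      split; rewrite ?cats0 ?rg_set_reg ?eqxx //; first by apply: ok_set_reg => //; lia.
      apply: same_set_reg; first by rewrite inE eqxx.
      apply: same_trans fr _; apply: same_sub fr1 => // x; rewrite inE => ->; exact: orbT.
    move=> s1 w1 ok1 _ [_ fr1 r1 I1].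
    apply: tr_weaken; first by apply: (IH i.+1 _ _ _ s1 (w ++ w1)) => //; lia.
      by [].
    by move=> s2 w2 _ _; rewrite catA.
  - by rewrite /=; lia.
apply: (@tr_weaken _ _ ((cost lo).+1 + (cost hi + 3 + \sum_(l <= j < h) (T j + (cost hi + 7)))) _
  (fun s'' w' => rg s'' r = h /\ I h s'' w')) => //; last lia.
apply: (@tr_seq _ _ _ _ _ (fun s' w => s' = set_reg s r l /\ w = [::])).
  by apply: tr_set => //; rewrite elo // (leq_trans lh).
move=> s1 w1 _ _ [-> ->]; apply: (key l _ [::]) => //.
- by rewrite leqnn.
- by apply: ok_set_reg => //; apply: leq_trans hV.
- by apply: same_set_reg; rewrite ?inE ?eqxx.
- by rewrite rg_set_reg eqxx.
Qed.

Lemma tr_seq_le T1 T2 p1 p2 s T Q1 Q : tr p1 s T1 Q1 -> T1 + T2 <= T ->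
  (forall s1 w1, ok s1 -> same (rmods p1) (amods p1) s s1 -> Q1 s1 w1 ->
     tr p2 s1 T2 (fun s2 w2 => Q s2 (w1 ++ w2))) ->
  tr (Seq p1 p2) s T Q.
Proof. by move=> h1 hT h2; apply: (tr_weaken (tr_seq h1 h2)). Qed.

Lemma tr_if_le T0 e p1 p2 s T Q : (cost e).+1 + T0 <= T ->
  tr (if ev s e != 0 then p1 else p2) s T0 Q -> tr (If e p1 p2) s T Q.
Proof. by move=> hT h; apply: (tr_weaken (tr_if h)). Qed.

Lemma tr_le p s T T' Q : tr p s T Q -> T <= T' -> tr p s T' Q.
Proof. by move=> h hT; apply: tr_weaken h hT _. Qed.

End Logic.

Section Loops.
Variables (inp : seq (seq nat)) (L V : nat).
Local Notation ok := (ok L V).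
Local Notation ev := (ev inp).
Local Notation tr := (tr inp L V).
Implicit Types (p : prog) (s : memory) (e : expr) (Q : memory -> seq nat -> Prop).

(** The expression [e] may read the very entry that is about to be overwritten, hence the assumption
    that this entry is still the original one. The last loop of [close] relies on this. *)
Lemma tr_fill a hi e s h (g : nat -> nat) :
    ok s -> a < num_arrs -> h <= V -> h <= L ->
    (forall s', same [:: 5] [:: a] s s' -> ev s' hi = h) ->
    (forall v, v < h -> g v <= V) ->
    (forall v s', v < h -> same [:: 5] [:: a] s s' -> rg s' 5 = v -> ar s' a v = ar s a v ->
       ev s' e = g v) ->
  tr (For 5 (Cst 0) hi (SetArr a (Reg 5) e)) s ((h + 1) * (cost e + cost hi + 14))
    (fun s' w => w = [::] /\ forall v, v < h -> ar s' a v = g v).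
Proof.
move=> oks ha hV hL ehi gV ee.
pose I i s' (w : seq nat) := [/\ w = [::], forall v, v < i -> ar s' a v = g v
  & forall v, i <= v -> ar s' a v = ar s a v].
apply: (@tr_weaken _ _ _ _ _ _ _ (fun s' w => rg s' 5 = h /\ I h s' w)).
- apply: (@tr_for _ _ _ _ _ _ _ _ 0 h (fun=> cost e + 2) I) => //.
  + move=> i s' w /andP[_ ih] oks' fr r5 [-> h1 h2].
    have E : ev s' e = g i by apply: ee => //; apply: h2.
    apply: tr_weaken; first apply: (@tr_arr _ _ _ _ _ _ _
        (fun s'' w => w = [::] /\ s'' = set_arr s' a i (g i))) => //=.
    * by rewrite r5 (leq_trans ih).
    * by rewrite E gV.
    * by rewrite r5 E.
    * by rewrite /=; lia.
    move=> s'' w' _ _ [-> ->]; split=> // v; rewrite !memE eqxx /=.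
      by rewrite ltnS leq_eqVlt; case: eqP => [->|_ /h1].
    by case: eqP => [->|_ vi]; [rewrite ltnn|rewrite h2 // ltnW].
- rewrite sum_nat_const_nat subn0 /= mulnDl !mulnDr. lia.
by move=> s' w _ _ [_ []].
Qed.

(** Partial sums are bounded by the total, so only the total is compared with [V]. The same holds
    for the entries in [tr_scatter]. *)
Lemma tr_sum r x lo hi e s l h (g : nat -> nat) :
    ok s -> r < num_regs -> x < num_regs -> r != x -> h <= V -> l <= h ->
    ev (set_reg s x 0) lo = l ->
    (forall s', same [:: r; x] [::] s s' -> ev s' hi = h) ->
    \sum_(l <= i < h) g i <= V ->
    (forall i s', l <= i < h -> same [:: r; x] [::] s s' -> rg s' r = i -> ev s' e = g i) ->
  tr (Sum r x lo hi e) s ((h - l + 1) * (cost e + cost hi + cost lo + 14))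
    (fun s' w => w = [::] /\ rg s' x = \sum_(l <= i < h) g i).
Proof.
move=> oks rn xn rx hV lh elo ehi sV ee.
pose I i s' (w : seq nat) := w = [::] /\ rg s' x = \sum_(l <= j < i) g j.
have xr : (x == r) = false by rewrite eq_sym (negbTE rx).
apply: (@tr_weaken _ _ _ _ _ (2 + (cost lo + cost hi + 4 + (h - l) * (cost e + 3 + (cost hi + 7))))
  _ (fun s' w => rg s' r = h /\ I h s' w)).
- apply: (@tr_seq _ _ _ _ _ _ _ _ (fun s' w => w = [::] /\ s' = set_reg s x 0)).
    by apply: tr_set.
  move=> s1 w1 ok1 _ [-> E1]; rewrite -sum_nat_const_nat.
  have fr1 : same [:: r; x] [::] s s1 by rewrite E1; apply: same_set_reg; rewrite ?inE ?eqxx ?orbT.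
  apply: (@tr_for _ _ _ _ _ _ _ _ l h (fun=> cost e + 3) I) => //=.
  + by rewrite E1.
  + by move=> s' fr; apply: ehi; apply: same_trans fr1 _.
  + by rewrite inE.
  + by rewrite /I E1 !memE xr big_geq // eqxx.
  move=> i s' w /andP[li ih] oks' fr ri [-> rx'].
  have E : ev s' e = g i.
    by apply: ee; rewrite ?li //; apply: same_trans fr1 _.
  have le_i : \sum_(l <= j < i.+1) g j <= V.
    by apply: leq_trans sV; rewrite (big_cat_nat (n := i.+1) (leq_trans li (leqnSn i)) ih) //= leq_addr.
  apply: tr_weaken; first apply: (@tr_set _ _ _ _ _ _
      (fun s'' w => w = [::] /\ s'' = set_reg s' x (\sum_(l <= j < i.+1) g j))) => //=.
  * by rewrite rx' E -big_nat_recr.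
  * by rewrite rx' E -big_nat_recr.
  * by rewrite /=; lia.
  by move=> s'' w' _ _ [-> ->]; split=> //; rewrite !memE xr eqxx.
- nia.
by move=> s' w _ _ [_ []].
Qed.

Lemma tr_scatter lo hi e1 e2 s l h (k g : nat -> nat) :
    ok s -> h <= V -> l <= h -> ev s lo = l ->
    (forall s', same [:: 1] [:: 2] s s' -> ev s' hi = h) ->
    (forall i, l <= i < h -> k i < L) ->
    (forall v, ar s 2 v + \sum_(l <= i < h | k i == v) g i <= V) ->
    (forall i s', l <= i < h -> same [:: 1] [:: 2] s s' -> rg s' 1 = i ->
       ev s' e1 = k i /\ ev s' e2 = g i) ->
  tr (For 1 lo hi (SetArr 2 e1 (Op OAdd (Arr 2 e1) e2))) s
    ((h - l + 1) * (2 * cost e1 + cost e2 + cost hi + cost lo + 14))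
    (fun s' w => w = [::] /\
       forall v, ar s' 2 v = ar s 2 v + \sum_(l <= i < h | k i == v) g i).
Proof.
move=> oks hV lh elo ehi kL sV ee.
pose I i s' (w : seq nat) := w = [::] /\
  forall v, ar s' 2 v = ar s 2 v + \sum_(l <= j < i | k j == v) g j.
apply: (@tr_weaken _ _ _ _ _ (cost lo + cost hi + 4 + (h - l) * (2 * cost e1 + cost e2 + 3 + (cost hi + 7)))
  _ (fun s' w => rg s' 1 = h /\ I h s' w)).
- rewrite -sum_nat_const_nat.
  apply: (@tr_for _ _ _ _ _ _ _ _ l h (fun=> 2 * cost e1 + cost e2 + 3) I) => //=.
  + by split=> // v; rewrite !memE big_geq // addn0.
  move=> i s' w /andP[li ih] oks' fr ri [-> rx'].
  have [E1 E2] : ev s' e1 = k i /\ ev s' e2 = g i by apply: ee; rewrite ?li.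
  have rec v : ar s' 2 v + (if k i == v then g i else 0) =
      ar s 2 v + \sum_(l <= j < i.+1 | k j == v) g j.
    by rewrite rx' -addnA big_mkcond [in RHS]big_mkcond big_nat_recr.
  apply: tr_weaken; first apply: (@tr_arr _ _ _ _ _ _ _
      (fun s'' w => w = [::] /\ s'' = set_arr s' 2 (k i) (ar s' 2 (k i) + g i))) => //=.
  * by rewrite E1 kL // li.
  * rewrite E1 E2; have := rec (k i); rewrite eqxx => ->.
    apply: leq_trans (sV (k i)); rewrite leq_add2l.
    by rewrite [leqRHS](big_cat_nat (n := i.+1) (leq_trans li (leqnSn i)) ih) //= leq_addr.
  * by rewrite E1 E2.
  * by rewrite /=; lia.
  move=> s'' w' _ _ [-> ->]; split=> // v; rewrite !memE -rec eqxx /= eq_sym.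
  by case: eqP => [->|]; rewrite ?addn0.
- nia.
by move=> s' w _ _ [_ []].
Qed.

End Loops.

(** * The subroutines of the algorithm *)

(* Registers: 0 list, 1 position in the array of lists, 2 size of a trace on the
   list, 3 size of the set, 4 number of lists containing the set, 5 element,
   6 element added to the current set, 7 number of violations, 8 success flag,
   9 rank, 10 and 11 size and list of the best cut, 12 descent step.
   Arrays: 0 current closed set, 1 generators of the candidate, 2 scratch and
   closure, 3 successor, 4 vertex set of the face, 5 face in the descent. *)
Definition eN a := Inp 0 (Cst a).
Definition eM a := Inp 0 (Cst (1 - a)).
Definition off a e := Inp (1 + a.*2) e.
Definition lst a e := Inp (2 + a.*2) e.

Definition count a X :=
  Sum 1 2 (off a (Reg 0)) (off a (Op OAdd (Reg 0) (Cst 1))) (Arr X (lst a (Reg 1))).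

Definition card a X := Sum 5 3 (Cst 0) (eN a) (Arr X (Reg 5)).

Definition scatter a e := For 1 (off a (Reg 0)) (off a (Op OAdd (Reg 0) (Cst 1)))
  (SetArr 2 (lst a (Reg 1)) (Op OAdd (Arr 2 (lst a (Reg 1))) e)).

(** A row contains the generators exactly when its trace on them has full size. Register 4 counts
    such rows and array 2 counts, for each element, those that contain it; an element is in the
    closure when the two counts agree. Every list is scanned at most twice. *)
Definition close a :=
  Seq (card a 1)
  (Seq (For 5 (Cst 0) (eN a) (SetArr 2 (Reg 5) (Cst 0)))
  (Seq (SetReg 4 (Cst 0))
  (Seq (For 0 (Cst 0) (eM a)
          (Seq (count a 1)
               (If (Op OEq (Reg 2) (Reg 3))
                   (Seq (SetReg 4 (Op OAdd (Reg 4) (Cst 1))) (scatter a (Cst 1)))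
                   Skip)))
       (For 5 (Cst 0) (eN a) (SetArr 2 (Reg 5) (Op OEq (Arr 2 (Reg 5)) (Reg 4))))))).

(** The test [Reg 10 < Reg 2 + 1] is a weak inequality, so that even an empty trace replaces the
    initial value 0 and sets register 11. On an empty face nothing happens. *)
Definition descend a :=
  Seq (card a 5)
  (If (Reg 3)
    (Seq (SetReg 9 (Op OAdd (Reg 9) (Cst 1)))
    (Seq (SetReg 10 (Cst 0))
    (Seq (SetReg 11 (Cst 0))
    (Seq (For 0 (Cst 0) (eM a)
            (Seq (count a 5)
               (If (Op OMul (Op OLt (Reg 2) (Reg 3)) (Op OLt (Reg 10) (Op OAdd (Reg 2) (Cst 1))))
                   (Seq (SetReg 10 (Reg 2)) (SetReg 11 (Reg 0)))
                   Skip)))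
    (Seq (For 5 (Cst 0) (eN a) (SetArr 2 (Reg 5) (Cst 0)))
    (Seq (SetReg 0 (Reg 11))
    (Seq (scatter a (Arr 5 (lst a (Reg 1))))
         (For 5 (Cst 0) (eN a) (SetArr 5 (Reg 5) (Arr 2 (Reg 5)))))))))))
    Skip).

(** Register 9 counts the descent steps made before the face becomes empty, which is its rank;
    [steps] only has to be an upper bound for it. *)
Definition emit a steps :=
  Seq (For 5 (Cst 0) (eN a) (SetArr 5 (Reg 5) (Arr 4 (Reg 5))))
  (Seq (SetReg 9 (Cst 0))
  (Seq (For 12 (Cst 0) steps (descend a))
  (Seq (Emit (Reg 9))
  (Seq (card a 4)
  (Seq (Emit (Reg 3))
       (For 5 (Cst 0) (eN a) (If (Arr 4 (Reg 5)) (Emit (Reg 5)) Skip))))))).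

Definition rep (s : memory) (x N : nat) (T : {set 'I_N}) := forall j : 'I_N, ar s x j = (j \in T).

Definition polar_prog a :=
  Seq (card a 0)
      (For 0 (Cst 0) (eM a)
         (Seq (count a 0) (SetArr 4 (Reg 0) (Op OEq (Reg 2) (Reg 3))))).

Definition attempt a :=
  Seq (For 5 (Cst 0) (eN a)
         (SetArr 1 (Reg 5)
            (Op OAdd (Op OMul (Op OLt (Reg 5) (Reg 6)) (Arr 0 (Reg 5)))
                     (Op OEq (Reg 5) (Reg 6)))))
  (Seq (close a)
  (Seq (Sum 5 7 (Cst 0) (Reg 6) (Op OLt (Arr 0 (Reg 5)) (Arr 2 (Reg 5))))
       (If (Reg 7) Skip
           (Seq (SetReg 8 (Cst 1))
                (For 5 (Cst 0) (eN a) (SetArr 3 (Reg 5) (Arr 2 (Reg 5)))))))).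

(** Indices are tried in increasing order and each success overwrites array 3, so the candidate of
    the largest good index remains. Without any success register 8 stays 0, which ends the
    enumeration. *)
Definition next a :=
  Seq (SetReg 8 (Cst 0))
  (Seq (For 6 (Cst 0) (eN a) (If (Arr 0 (Reg 6)) Skip (attempt a)))
       (For 5 (Cst 0) (eN a) (SetArr 0 (Reg 5) (Arr 3 (Reg 5))))).

Definition enumeration a out :=
  Seq (SetReg 8 (Cst 1)) (While (Reg 8) (Seq out (next a))).

(** * Rows of the incidence matrix and their lists *)

Section Rows.
Variables (M N : nat) (B : 'M[bool]_(M, N)).

Definition row_list f : seq nat := nth [::] (row_lists B) f.
Definition row_start f : nat := sumn (take f (shape (row_lists B))).
(** Rows are indexed by natural numbers to match the loop counters; from [M] on the set is empty. *)
Definition row_set f : {set 'I_N} := [set j | [exists i : 'I_M, (val i == f) && B i j]].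

Lemma row_setE (i : 'I_M) : row_set i = [set j | B i j].
Proof.
apply/setP => j; rewrite !inE; apply/existsP/idP => [[i' /andP[/eqP/val_inj -> //]]|h].
by exists i; rewrite eqxx.
Qed.

Lemma size_row_lists : size (row_lists B) = M.
Proof. by rewrite /row_lists size_map size_enum_ord. Qed.

Lemma row_listE (i : 'I_M) : row_list i = [seq val j | j <- enum 'I_N & B i j].
Proof. by rewrite /row_list /row_lists (nth_map i) ?size_enum_ord // nth_ord_enum. Qed.

Lemma big_row_list f (F : nat -> nat) : f < M ->
  \sum_(x <- row_list f) F x = \sum_(j in row_set f) F j.
Proof.
move=> fM; rewrite (row_listE (Ordinal fM)) big_map big_filter big_enum_cond.
by apply: eq_bigl => j; rewrite (row_setE (Ordinal fM)) !inE.
Qed.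

Lemma size_row_list f : f < M -> size (row_list f) = #|row_set f|.
Proof.
move=> fM; rewrite -sum1_size -sum1_card.
exact: (@big_row_list f (fun=> 1)).
Qed.

Lemma row_startS f : f < M -> row_start f.+1 = row_start f + #|row_set f|.
Proof.
move=> fM; have sz : size (shape (row_lists B)) = M by rewrite size_map size_row_lists.
rewrite /row_start (take_nth 0) ?sz //.
by rewrite sumn_rcons (nth_map [::]) ?size_row_lists // -/(row_list f) size_row_list.
Qed.

Lemma row_start_sum f : f <= M -> row_start f = \sum_(0 <= i < f) #|row_set i|.
Proof.
elim: f => [|f IH] hf; first by rewrite big_geq // /row_start take0.
by rewrite row_startS // (IH (ltnW hf)) [RHS]big_nat_recr.
Qed.

Lemma row_start_le f : f <= M -> row_start f <= row_start M.
Proof.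
move=> fM; rewrite !row_start_sum // [leqRHS](big_cat_nat (n := f)) //= leq_addr //.
Qed.

Lemma row_start_incidences : row_start M = incidences B.
Proof.
rewrite row_start_sum // big_mkord; apply: eq_bigr => i _; rewrite row_setE.
by rewrite -sum1_card big_mkcond; apply: eq_bigr => j _; rewrite inE; case: (B i j).
Qed.

(** The amortisation step: a cost proportional to the length of each list adds up to the number of
    incidences plus the number of rows. *)
Lemma sum_rows c : \sum_(0 <= f < M) (c * (#|row_set f| + 1)) = c * (row_start M + M).
Proof. by rewrite -big_distrr big_split -row_start_sum //= sum_nat_const_nat muln1 subn0. Qed.

Lemma gclosure_rows (T : {set 'I_N}) (j : 'I_N) :
  reflect (forall f, f < M -> T \subset row_set f -> j \in row_set f) (j \in gclosure B T).
Proof.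
apply: (iffP (mem_gclosure _ _ _)) => h.
  move=> f fM; rewrite (row_setE (Ordinal fM)) inE => /subsetP hT.
  by apply: h => l /hT; rewrite inE.
move=> i hi; have := h i (ltn_ord i); rewrite row_setE inE; apply.
by apply/subsetP => l /hi; rewrite inE.
Qed.

End Rows.

(* Side 0 works on the vertices and side 1 on the facets, whose lists are in
   arrays 1, 2 and 3, 4 of the sparse format, respectively. *)
Definition input_side (inp : seq (seq nat)) (a M N : nat) (B : 'M[bool]_(M, N)) : Prop :=
  [/\ ip inp 0 a = N, ip inp 0 (1 - a) = M,
      forall f, f <= M -> ip inp (1 + a.*2) f = row_start B f
    & forall f i, f < M -> i < size (row_list B f) ->
        ip inp (2 + a.*2) (row_start B f + i) = nth 0 (row_list B f) i].

(** * Correctness and cost of the subroutines on one side of the matrix *)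

Section Side.
Variables (inp : seq (seq nat)) (L V : nat) (a M N : nat) (B : 'M[bool]_(M, N)).
Hypotheses (HI : input_side inp a B).
Hypotheses (NV : N <= V) (MV : M <= V) (rV : row_start B M <= V).
Local Notation ok := (ok L V).
Local Notation ev := (ev inp).
Local Notation tr := (tr inp L V).
Implicit Types (s : memory) (e : expr) (S T : {set 'I_N}).

Lemma ev_eN s : ev s (eN a) = N. Proof. by case: HI. Qed.
Lemma ev_eM s : ev s (eM a) = M. Proof. by case: HI. Qed.

Lemma big_row f (F : nat -> nat) : f < M ->
  \sum_(row_start B f <= p < row_start B f.+1) F (ip inp (2 + a.*2) p) =
  \sum_(j in row_set B f) F j.
Proof.
case: HI => _ _ _ hl fM; rewrite -big_row_list // [RHS](big_nth 0) row_startS //.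
move: (hl f) => {}hl; move: (row_start B f) hl => r hl.
have := big_addn 0 (r + #|row_set B f|) r predT (fun p => F (ip inp (2 + a.*2) p)).
rewrite add0n => ->; rewrite addKn -size_row_list // !big_mkord.
by apply: eq_bigr => i _; rewrite (addnC (val i) r) hl //; apply: ltn_ord.
Qed.

Lemma row_entry f p : f < M -> row_start B f <= p < row_start B f.+1 ->
  exists2 j : 'I_N, ip inp (2 + a.*2) p = j & j \in row_set B f.
Proof.
case: HI => _ _ _ hl fM /andP[h1 h2].
have lt_i : p - row_start B f < size (row_list B f).
  by move: h2; rewrite row_startS // size_row_list //; lia.
have := hl f _ fM lt_i; rewrite subnKC // => ->.
have := mem_nth 0 lt_i; rewrite {2}(row_listE _ (Ordinal fM)) => /mapP[j].
by rewrite mem_filter => /andP[Bj _] ->; exists j; rewrite ?(row_setE _ (Ordinal fM)) ?inE.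
Qed.

Lemma ev_off s f e : ev s e = f -> f <= M -> ev s (off a e) = row_start B f.
Proof. by move=> /= -> fM; case: HI => _ _ -> . Qed.

Lemma tr_card X s T : ok s -> rep s X T ->
  tr (card a X) s (20 * (N + 1)) (fun s' w => w = [::] /\ rg s' 3 = #|T|).
Proof.
move=> oks hX; pose g j := ar s X j.
have gE : \sum_(0 <= j < N) g j = #|T|.
  by rewrite big_mkord -sum1_card [RHS]big_mkcond; apply: eq_bigr => j _; rewrite /g hX; case: (j \in T).
apply: tr_weaken; first apply: (@tr_sum _ _ _ _ _ _ _ _ _ 0 N g) => //.
- by move=> s' _; apply: ev_eN.
- by rewrite gE (leq_trans (max_card _)) // card_ord.
- by move=> i s' _ fr /= r5; rewrite r5 fr.2.
- by rewrite /=; lia.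
by move=> s' w _ _ [-> ->]; rewrite gE.
Qed.

Lemma tr_count X s T f : ok s -> rep s X T -> rg s 0 = f -> f < M ->
  tr (count a X) s (23 * (#|row_set B f| + 1))
    (fun s' w => w = [::] /\ rg s' 2 = #|T :&: row_set B f|).
Proof.
move=> oks hX r0 fM; pose g p := ar s X (ip inp (2 + a.*2) p).
have gE : \sum_(row_start B f <= p < row_start B f.+1) g p = #|T :&: row_set B f|.
  rewrite (@big_row f (ar s X)) // -sum1_card big_mkcond [RHS]big_mkcond.
  by apply: eq_bigr => j _; rewrite in_setI hX; case: (j \in row_set B f); case: (j \in T).
apply: tr_weaken; first apply: (@tr_sum _ _ _ _ _ _ _ _ _ (row_start B f) (row_start B f.+1) g) => //.
- by apply: leq_trans rV; apply: row_start_le.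
- by rewrite row_startS // leq_addr.
- by apply: ev_off; [rewrite /= memE|apply: ltnW].
- by move=> s' fr; apply: ev_off => //=; rewrite fr.1 // r0 addn1.
- by rewrite gE (leq_trans _ NV) // (leq_trans (max_card _)) // card_ord.
- by move=> i s' _ fr /= r5; rewrite r5 fr.2.
- by rewrite row_startS // addKn /=; lia.
by move=> s' w _ _ [-> ->]; rewrite gE.
Qed.

Lemma tr_scatter_row e s f (g : nat -> nat) : ok s -> N <= L -> cost e <= 4 -> rg s 0 = f -> f < M ->
    (forall j : 'I_N, ar s 2 j + (j \in row_set B f) * g j <= V) ->
    (forall j s', j < N -> same [:: 1] [:: 2] s s' -> ip inp (2 + a.*2) (rg s' 1) = j ->
       ev s' e = g j) ->
  tr (scatter a e) s (40 * (#|row_set B f| + 1))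
    (fun s' w => w = [::] /\ forall j : 'I_N, ar s' 2 j = ar s 2 j + (j \in row_set B f) * g j).
Proof.
move=> oks NL ce r0 fM gV ee; pose k p := ip inp (2 + a.*2) p.
have gE v : \sum_(row_start B f <= p < row_start B f.+1 | k p == v) g (k p) =
    \sum_(j in row_set B f | val j == v) g v.
  rewrite big_mkcond (@big_row f (fun x => if x == v then g x else 0)) // big_mkcondr.
  by apply: eq_bigr => j _; case: eqP => // ->.
have gE' (j : 'I_N) : \sum_(l in row_set B f | val l == j) g j = (j \in row_set B f) * g j.
  rewrite big_mkcondr; case: (boolP (j \in row_set B f)) => jf.
    rewrite (bigD1 j) //= eqxx big1 ?addn0 ?mul1n // => l /andP[_ lj].
    by rewrite (_ : (val l == j) = false) //; apply: negbTE.
  by rewrite big1 // => l lf; case: eqP => // /val_inj lj; rewrite -lj lf in jf.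
apply: tr_weaken; first apply: (@tr_scatter _ _ _ _ _ _ _ _ (row_start B f) (row_start B f.+1) k (fun p => g (k p))) => //.
- by apply: leq_trans rV; apply: row_start_le.
- by rewrite row_startS // leq_addr.
- by apply: ev_off; [|apply: ltnW].
- by move=> s' fr; apply: ev_off => //=; rewrite fr.1 // r0 addn1.
- by move=> p /(row_entry fM)[j kE _]; rewrite /k kE (leq_trans _ NL).
- move=> v; rewrite gE; case: (ltnP v N) => vN.
    by have := gV (Ordinal vN); rewrite -gE'.
  rewrite big1 ?addn0; last by move=> j /andP[_ /eqP jv]; have := ltn_ord j; rewrite jv ltnNge vN.
  exact: ok_ar oks.
- move=> p s' hp fr r1; split; first by rewrite /= r1.
  have [j kE _] := row_entry fM hp; apply: ee => //; first by rewrite /k kE.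
  by rewrite r1.
- rewrite row_startS // addKn mulnC leq_mul2r; apply/orP; right; rewrite /=; lia.
by move=> s' w _ _ [-> h]; split=> // j; rewrite h gE gE'.
Qed.

(** Up to a constant factor, the cost of one pass over all lists and over the ground set. *)
Definition work := N + M + row_start B M + 1.

(** Lets one comparison of two counters decide whether an element lies in all the rows that contain
    the generators. *)
Lemma sum_all_eq (K : nat) (b c : nat -> bool) :
  (\sum_(0 <= f < K) (b f && c f) == \sum_(0 <= f < K) b f) = [forall f : 'I_K, b f ==> c f].
Proof.
rewrite !big_mkord.
have le f : b f && c f <= b f ?= iff (b f ==> c f).
  by split; case: (b f); case: (c f).
have := leqif_sum (fun (f : 'I_K) (_ : true) => le f) => -[_ ->].
by apply: eq_forallb => f.
Qed.

Lemma card_setI_eq (T X : {set 'I_N}) : (#|T :&: X| == #|T|) = (T \subset X).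
Proof.
by rewrite (subset_leqif_cards (subsetIl T X)); apply/eqP/idP => [/setIidPl|/setIidPl].
Qed.

Lemma tr_close s T : ok s -> N <= L -> rep s 1 T ->
  tr (close a) s (140 * work) (fun s' w => w = [::] /\ rep s' 2 (gclosure B T)).
Proof.
move=> oks NL h1; rewrite /close.
apply: (tr_seq_le (T2 := 120 * work) (tr_card oks h1)); first by rewrite /work; lia.
move=> s1 w1 ok1 fr1 [-> r3] /=.
apply: (tr_seq_le (T1 := 17 * (N + 1)) (T2 := 103 * work)
  (Q1 := fun s' w => w = [::] /\ forall v, v < N -> ar s' 2 v = 0)).
- apply: tr_le; first apply: (@tr_fill _ _ _ 2 _ _ _ N (fun=> 0)) => //.
    by move=> s' _; apply: ev_eN.
  by rewrite /=; lia.
- by rewrite /work; lia.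
move=> s2 w2 ok2 fr2 [-> z2] /=.
apply: (tr_seq_le (T1 := 2) (T2 := 101 * work) (Q1 := fun s' w => w = [::] /\ s' = set_reg s2 4 0)).
- exact: tr_set.
- by rewrite /work; lia.
move=> s3 w3 ok3 _ [-> E3] /=.
have r33 : rg s3 3 = #|T| by rewrite E3 memE fr2.1.
have h13 : rep s3 1 T by move=> j; rewrite E3 memE fr2.2 // fr1.2.
pose hit f := T \subset row_set B f.
pose I f s' (w : seq nat) := [/\ w = [::], rg s' 4 = \sum_(0 <= i < f) hit i &
  forall j : 'I_N, ar s' 2 j = \sum_(0 <= i < f) (hit i && (j \in row_set B i))].
have hit_le f : \sum_(0 <= i < f) hit i <= f.
  by rewrite -[leqRHS]subn0 -[leqRHS]muln1 -sum_nat_const_nat leq_sum // => i _; case: (hit i).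
have hit_le' f (j : 'I_N) : \sum_(0 <= i < f) (hit i && (j \in row_set B i)) <= f.
  by rewrite -[leqRHS]subn0 -[leqRHS]muln1 -sum_nat_const_nat leq_sum // => i _; case: (_ && _).
apply: (tr_seq_le (T1 := 7 + 81 * (row_start B M + M)) (T2 := 20 * (N + 1))
  (Q1 := fun s' w => rg s' 0 = M /\ I M s' w)).
- rewrite -sum_rows; apply: tr_le; first apply: (@tr_for _ _ _ _ _ _ _ _ 0 M (fun f => 72 * (#|row_set B f| + 1)) I) => //.
  + by move=> s' _; apply: ev_eM.
  + split; rewrite // E3 ?memE ?big_geq // => j.
    by rewrite !memE z2 // big_geq.
  + move=> i s' w /andP[_ iM] ok' fr r0 [-> k4 y2].
    have rep1 : rep s' 1 T by move=> j; rewrite fr.2.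
    have r3' : rg s' 3 = #|T| by rewrite fr.1.
    apply: (tr_seq_le (T2 := 49 * (#|row_set B i| + 1)) (tr_count ok' rep1 r0 iM)); first by lia.
    move=> s4 w4 ok4 fr4 [-> c4] /=.
    apply: (tr_if_le (T0 := 45 * (#|row_set B i| + 1))); first by rewrite /=; clear; lia.
    have -> : (ev s4 (Op OEq (Reg 2) (Reg 3)) != 0) = hit i.
      by rewrite /= c4 fr4.1 // r3' card_setI_eq -/(hit i); case: (hit i).
    case: ifP => hi; last first.
      apply: tr_le; first apply: tr_skip => //.
        split; rewrite // ?memE ?fr4.1 ?k4 ?big_nat_recr //= ?hi ?addn0 // => j.
        by rewrite memE fr4.2 // y2 big_nat_recr //= hi addn0.
      by lia.
    have k4' : rg s4 4 + 1 = \sum_(0 <= l < i.+1) hit l.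
      by rewrite fr4.1 // k4 big_nat_recr //= hi.
    apply: (tr_seq_le (T1 := 4) (T2 := 40 * (#|row_set B i| + 1))
      (Q1 := fun s' w => w = [::] /\ s' = set_reg s4 4 (rg s4 4 + 1))).
    - by apply: tr_set => //=; rewrite k4' (leq_trans (hit_le _)) // (leq_trans iM).
    - by lia.
    move=> s5 w5 ok5 fr5 [-> E5] /=.
    have y5 (j : 'I_N) : ar s5 2 j = \sum_(0 <= l < i) (hit l && (j \in row_set B l)).
      by rewrite fr5.2 // fr4.2 // y2.
    have yS (j : 'I_N) : ar s5 2 j + (j \in row_set B i) * 1 =
        \sum_(0 <= l < i.+1) (hit l && (j \in row_set B l)).
      by rewrite y5 big_nat_recr //= hi muln1.
    apply: tr_weaken; first apply: (@tr_scatter_row _ _ i (fun=> 1)) => //.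
    - by rewrite fr5.1 // fr4.1.
    - by move=> j; rewrite yS (leq_trans (hit_le' _ _)) // (leq_trans iM).
    - by [].
    move=> s6 w6 ok6 fr6 [-> y6]; split; rewrite // ?memE.
      by rewrite fr6.1 // E5 memE.
    by move=> j; rewrite memE y6 yS.
  + rewrite sum_rows big_split -big_distrr /= big_split /= -row_start_sum //.
    rewrite !sum_nat_const_nat; lia.
- by rewrite /work; lia.
move=> s4 w4 ok4 fr4 [_ [-> k4 y4]] /=.
apply: tr_weaken; first apply: (@tr_fill _ _ _ 2 _ _ _ N (fun v => ar s4 2 v == rg s4 4)) => //.
- by move=> s' _; apply: ev_eN.
- by move=> v vN; rewrite (leq_trans (leq_b1 _)) // (leq_trans _ NV) // (leq_ltn_trans _ vN).
- by move=> v s' vN fr /= r5; rewrite r5 fr.1 // => ->.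
- by rewrite /=; lia.
move=> s5 w5 _ _ [-> y5]; split=> // j; rewrite y5 // y4 k4 sum_all_eq; congr nat_of_bool.
apply/forallP/gclosure_rows => [h f fM hf|h f]; first exact: (implyP (h (Ordinal fM)) hf).
by apply/implyP => hf; apply: h.
Qed.

Lemma tr_polar s T : ok s -> M <= L -> rep s 0 T ->
  tr (polar_prog a) s (60 * work) (fun s' w => w = [::] /\ rep s' 4 (polar B T)).
Proof.
move=> oks ML h0; apply: (tr_seq_le (T2 := 40 * work) (tr_card oks h0)); first by rewrite /work; lia.
move=> s1 w1 ok1 fr1 [-> r3] /=.
pose I f s' (w : seq nat) := w = [::] /\ forall i : 'I_M, i < f -> ar s' 4 i = (T \subset row_set B i).
apply: tr_weaken; first apply: (@tr_for _ _ _ _ _ _ _ _ 0 M (fun f => 29 * (#|row_set B f| + 1)) I) => //.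
- by move=> s' _; apply: ev_eM.
- move=> i s' w /andP[_ iM] ok' fr r0 [-> y4].
  have rep0 : rep s' 0 T by move=> j; rewrite fr.2 // fr1.2.
  apply: (tr_seq_le (T2 := 5) (tr_count ok' rep0 r0 iM)); first by lia.
  move=> s2 w2 ok2 fr2 [-> c2] /=.
  have E : (rg s2 2 == rg s2 3) = (T \subset row_set B i).
    by rewrite c2 fr2.1 // fr.1 // r3 card_setI_eq.
  apply: tr_le; first apply: (@tr_arr _ _ _ _ _ _ _ _) => //=.
  + by rewrite fr2.1 // r0 (leq_trans iM).
  + by rewrite (leq_trans (leq_b1 _)) // (leq_trans _ MV) // (leq_ltn_trans _ iM).
  + split=> // l; rewrite !memE fr2.1 // r0 E /= ltnS leq_eqVlt.
    by case: eqP => [->|_] //= li; rewrite fr2.2 // y4.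
  by [].
- rewrite big_split -big_distrr /= big_split /= -row_start_sum // !sum_nat_const_nat /work; lia.
move=> s2 w2 _ _ [_ [-> h]]; split=> // i; rewrite h //; congr nat_of_bool.
apply/subsetP/polarP => hT j /hT; by rewrite row_setE inE.
Qed.

Lemma candidate_rep S i (j : 'I_N) : (j < i) * (j \in S) + (j == i :> nat) =
  (j \in [set j : 'I_N | (j < i) && (j \in S) || (val j == i)]).
Proof. by rewrite inE /=; case: ltngtP => //=; case: (j \in S). Qed.

Lemma tr_attempt s S (i : 'I_N) : ok s -> N <= L -> rep s 0 S -> rg s 6 = i -> i \notin S ->
  tr (attempt a) s (220 * work) (fun s' w => w = [::] /\
    if good B S i then rg s' 8 = 1 /\ rep s' 3 (candidate B S i)
    else rg s' 8 = rg s 8 /\ forall j, ar s' 3 j = ar s 3 j).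
Proof.
move=> oks NL h0 r6 iS; have V0 : 0 < V by rewrite (leq_trans _ NV) // (leq_ltn_trans _ (ltn_ord i)).
pose T := [set j : 'I_N | (j < i) && (j \in S) || (val j == i)].
apply: (tr_seq_le (T1 := 26 * (N + 1)) (T2 := 190 * work) (Q1 := fun s' w => w = [::] /\ rep s' 1 T)).
- apply: tr_weaken; first apply: (@tr_fill _ _ _ 1 _ _ _ N (fun v => (v < i) * ar s 0 v + (v == i))) => //.
  + by move=> s' _; apply: ev_eN.
  + by move=> v vN; rewrite (h0 (Ordinal vN)) (candidate_rep S i (Ordinal vN)) (leq_trans (leq_b1 _)).
  + by move=> v s' vN fr /= r5 _; rewrite r5 fr.1 // r6 fr.2.
  + by rewrite /=; lia.
  by move=> s' w _ _ [-> h]; split=> // j; rewrite h // h0 candidate_rep.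
- by rewrite /work; lia.
move=> s1 w1 ok1 fr1 [-> h1] /=.
apply: (tr_seq_le (T2 := 50 * work) (tr_close ok1 NL h1)); first by lia.
move=> s2 w2 ok2 fr2 [-> h2] /=.
have h02 : rep s2 0 S by move=> j; rewrite fr2.2 // fr1.2.
have r62 : rg s2 6 = i by rewrite fr2.1 // fr1.1.
pose g j := nat_of_bool (ar s2 0 j < ar s2 2 j).
have le_i : \sum_(0 <= j < i) g j <= i.
  by rewrite -[leqRHS]subn0 -[leqRHS]muln1 -sum_nat_const_nat leq_sum // => l _; apply: leq_b1.
apply: (tr_seq_le (T1 := 21 * (N + 1)) (T2 := 25 * work)
  (Q1 := fun s' w => w = [::] /\ rg s' 7 = \sum_(0 <= j < i) g j)).
- apply: tr_le; first apply: (@tr_sum _ _ _ _ _ _ _ _ _ 0 i g) => //.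
  + by rewrite (leq_trans _ NV) // ltnW.
  + by move=> s' fr /=; rewrite fr.1.
  + by rewrite (leq_trans le_i) // (leq_trans _ NV) // ltnW.
  + by move=> j s' _ fr /= r5; rewrite r5 !fr.2.
  + by rewrite /= subn0; have := ltn_ord i; lia.
- by rewrite /work; lia.
move=> s3 w3 ok3 fr3 [-> r7] /=.
have goodE : good B S i = (rg s3 7 == 0).
  rewrite /good iS /= r7 big_mkord sum_nat_eq0; apply/forall_inP/forallP => [h j|h j ji].
    apply/implyP => _; have jN := ltn_trans (ltn_ord j) (ltn_ord i).
    have := h (Ordinal jN) (ltn_ord j); rewrite /g -[nat_of_ord j]/(nat_of_ord (Ordinal jN)) h02 h2.
    by rewrite -/(candidate B S i); case: (_ \in S); case: (_ \in _).
  have := h (Ordinal ji); rewrite /g /= h02 h2 -/(candidate B S i).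
  by case: (_ \in S); case: (_ \in _).
apply: (tr_if_le (T0 := 20 * (N + 1))); first by rewrite /= /work; lia.
rewrite goodE /=; case: eqP => r70 /=; last first.
  apply: tr_le; first apply: tr_skip => //.
    split=> //; split=> [|j]; first by rewrite fr3.1 // fr2.1 // fr1.1.
    by rewrite fr3.2 // fr2.2 // fr1.2.
  by lia.
apply: (tr_seq_le (T1 := 2) (T2 := 18 * (N + 1)) (Q1 := fun s' w => w = [::] /\ s' = set_reg s3 8 1)).
- exact: tr_set.
- by lia.
move=> s4 w4 ok4 _ [-> E4] /=.
apply: tr_weaken; first apply: (@tr_fill _ _ _ 3 _ _ _ N (fun v => ar s4 2 v)) => //.
- by move=> s' _; apply: ev_eN.
- move=> v vN; rewrite E4 memE fr3.2 // (h2 (Ordinal vN)); exact: leq_trans (leq_b1 _) V0.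
- by move=> v s' vN fr /= r5 _; rewrite r5 fr.2.
- by rewrite /=; lia.
move=> s5 w5 _ fr5 [-> h5]; split=> //; split; first by rewrite fr5.1 // E4 memE.
by move=> j; rewrite h5 // E4 memE fr3.2 // h2.
Qed.

Lemma tr_next s S : ok s -> N <= L -> rep s 0 S ->
  tr (next a) s (300 * ((N + 1) * work)) (fun s' w => w = [::] /\
    ((exists2 i, good B S i /\ forall j, good B S j -> j <= i &
        rg s' 8 = 1 /\ rep s' 0 (candidate B S i)) \/
     (forall i, ~~ good B S i) /\ rg s' 8 = 0)).
Proof.
move=> oks NL h0.
apply: (tr_seq_le (T1 := 2) (T2 := 290 * ((N + 1) * work)) (Q1 := fun s' w => w = [::] /\ s' = set_reg s 8 0)).
- exact: tr_set.
- by rewrite /work; lia.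
move=> s1 w1 ok1 _ [-> E1] /=.
pose I i s' (w : seq nat) := w = [::] /\
  ((exists2 k : 'I_N, good B S k /\ (forall j : 'I_N, j < i -> good B S j -> j <= k) &
     rg s' 8 = 1 /\ rep s' 3 (candidate B S k)) \/
   (forall j : 'I_N, j < i -> ~~ good B S j) /\ rg s' 8 = 0).
apply: (tr_seq_le (T1 := 7 + N * (240 * work)) (T2 := 18 * (N + 1))
  (Q1 := fun s' w => rg s' 6 = N /\ I N s' w)).
- apply: tr_le; first apply: (@tr_for _ _ _ _ _ _ _ _ 0 N (fun=> 230 * work) I) => //.
  + by move=> s' _; apply: ev_eN.
  + by split=> //; right; rewrite E1 !memE.
  + move=> i s' w /andP[_ iN] ok' fr r6 [-> hI].
    have rep0 : rep s' 0 S by move=> j; rewrite fr.2 // E1 memE.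
    apply: (tr_if_le (T0 := 220 * work)); first by rewrite /= /work; lia.
    rewrite /= r6 (rep0 (Ordinal iN)); case: (boolP (_ \in S)) => iS /=.
      have ng : ~~ good B S (Ordinal iN) by rewrite /good iS.
      apply: tr_le; first apply: tr_skip => //; last by rewrite /work; lia.
      split=> //; case: hI => [[k [gk hk] [r8 h3]]|[hk r8]]; [left; exists k|right].
      * split=> // j; rewrite ltnS leq_eqVlt => /orP[/eqP ji|/hk //].
        by rewrite (_ : j = Ordinal iN) ?(negbTE ng) //; apply: val_inj.
      * by rewrite memE; split=> // j; rewrite memE.
      * rewrite memE; split=> // j; rewrite ltnS leq_eqVlt => /orP[/eqP ji|/hk //].
        by rewrite (_ : j = Ordinal iN) //; apply: val_inj.
    apply: tr_weaken; first exact: (tr_attempt (i := Ordinal iN)).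
      by [].
    move=> s2 w2 _ _ [->]; case: ifP => [gi [r8 h3]|/negbT ng [r8 h3]]; split=> //.
      left; exists (Ordinal iN); first by split=> // j; rewrite ltnS.
      by rewrite memE; split=> // j; rewrite memE.
    case: hI => [[k [gk hk] [r8' h3']]|[hk r8']]; [left; exists k|right].
    * split=> // j; rewrite ltnS leq_eqVlt => /orP[/eqP ji|/hk //].
      by rewrite (_ : j = Ordinal iN) ?(negbTE ng) //; apply: val_inj.
    * by rewrite memE /= r8; split=> // j; rewrite memE h3.
    * rewrite memE /= r8; split=> // j; rewrite ltnS leq_eqVlt => /orP[/eqP ji|/hk //].
      by rewrite (_ : j = Ordinal iN) //; apply: val_inj.
  + by rewrite sum_nat_const_nat /= /work; nia.
- by rewrite /work; nia.
move=> s2 w2 ok2 fr2 [_ [-> hI]] /=.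
apply: tr_weaken; first apply: (@tr_fill _ _ _ 0 _ _ _ N (fun v => ar s2 3 v)) => //.
- by move=> s' _; apply: ev_eN.
- move=> v vN; exact: ok_ar ok2.
- by move=> v s' vN fr /= r5 _; rewrite r5 fr.2.
- by rewrite /=; lia.
move=> s3 w3 _ fr3 [-> h3]; split=> //.
case: hI => [[k [gk hk] [r8 h3']]|[hk r8]]; [left|right].
  exists k; first by split=> // j; apply: hk.
  by rewrite fr3.1 //; split=> // j; rewrite h3.
by rewrite fr3.1 //; split=> // j; apply: hk.
Qed.

Lemma tr_enumeration out (enc : {set 'I_N} -> seq nat) Tout s :
    N <= L -> 0 < V -> 0 \notin amods out ->
    (forall s' S, ok s' -> rep s' 0 S -> gclosure B S = S ->
       tr out s' Tout (fun _ w => w = enc S)) ->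
    gclosure B set0 = set0 -> ok s -> @rep s 0 N set0 ->
  tr (enumeration a out) s
    (4 + #|[set X | gclosure B X == X]| * (2 + Tout + 300 * ((N + 1) * work)))
    (fun _ w => exists l, [/\ uniq l, forall X, X \in l = (gclosure B X == X)
       & w = flatten (map enc l)]).
Proof.
move=> NL V0 out0 hout cl0 oks h0; set Tb := 2 + Tout + _.
have body s' S : ok s' -> rep s' 0 S -> gclosure B S = S ->
    tr (Seq out (next a)) s' (Tout + 300 * ((N + 1) * work)) (fun s1 w => w = enc S /\
      ((exists2 i, good B S i /\ forall j, good B S j -> j <= i &
        rg s1 8 = 1 /\ rep s1 0 (candidate B S i)) \/
       (forall i, ~~ good B S i) /\ rg s1 8 = 0)).
  move=> ok' rep0 cS; apply: tr_seq; first exact: hout.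
  move=> s1 w1 ok1 fr1 ->; have rep1 : rep s1 0 S by move=> j; rewrite fr1.2.
  apply: tr_weaken; [exact: (tr_next ok1 NL rep1)|by []|].
  by move=> s2 w2 _ _ [-> hs]; rewrite cats0.
have key r : forall s' S, #|above B S| <= r -> ok s' -> rep s' 0 S -> gclosure B S = S -> rg s' 8 != 0 ->
    tr (While (Reg 8) (Seq out (next a))) s' (2 + (#|above B S| + 1) * Tb)
      (fun _ w => exists l, [/\ uniq l, l =i S |: above B S & w = flatten (map enc l)]).
  elim: r => [|r IH] s' S hr ok' rep0 cS r8;
    (apply: (tr_le (T := 2 + (Tout + 300 * ((N + 1) * work)) + (2 + #|above B S| * Tb))); last by rewrite /Tb; lia);
    apply: (tr_while_step (e := Reg 8) r8 (body _ _ ok' rep0 cS)) => s1 w1 ok1 _ [->].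
  - case=> [[i [gi hi] [r81 rep1]]|[hn r81]].
      move: hr; rewrite leqn0 cards_eq0 (above_next gi hi) => /eqP/setP/(_ (candidate B S i)).
      by rewrite in_setU1 eqxx in_set0.
    rewrite (above_last hn) cards0; apply: tr_le; first apply: tr_while_end => //.
      by exists [:: S]; split=> // X; rewrite !inE orbF.
    by [].
  - case=> [[i [gi hi] [r81 rep1]]|[hn r81]]; last first.
      rewrite (above_last hn) cards0; apply: tr_le; first apply: tr_while_end => //.
        by exists [:: S]; split=> // X; rewrite !inE orbF.
      by [].
    have aE := above_next gi hi.
    have cE : #|above B S| = (#|above B (candidate B S i)|).+1.
      by rewrite aE cardsU1 notin_above.
    apply: tr_weaken; first apply: (IH s1 (candidate B S i)) => //.
    + by move: hr; rewrite cE.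
    + exact: gclosure_id.
    + by rewrite r81.
    + by rewrite cE addn1.
    move=> _ w2 _ _ [l [ul le ->]]; exists (S :: l); split=> //=.
      by rewrite ul andbT le -aE notin_above.
    by move=> X; rewrite inE le -aE in_setU1.
(* The empty set is closed and lectically smallest, so the enumeration started there meets every
   closed set. *)
have cA : [set X | gclosure B X == X] = set0 |: above B set0.
  apply/setP => X; rewrite inE; apply/eqP/idP => [/above0 //|].
  by rewrite !inE => /orP[/eqP -> //|/andP[/eqP]].
apply: (tr_seq_le (T1 := 2) (T2 := 2 + (#|above B set0| + 1) * Tb) (Q1 := fun s' w => w = [::] /\ s' = set_reg s 8 1)).
- exact: tr_set.
- by rewrite cA cardsU1 notin_above add1n addn1 addnA leqnn.
move=> s1 w1 ok1 _ [-> E1].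
apply: tr_weaken; first apply: (key _ s1 set0 (leqnn _)) => //.
- by move=> j; rewrite E1 memE.
- by rewrite E1 memE.
- by [].
move=> _ w _ _ [l [ul le ->]]; exists l; split=> // X; by rewrite le -cA inE.
Qed.

(* Among the proper traces on X, one of largest size is a maximal one, hence a
   lower cover of X; so each step of the descent lowers the rank by one. *)
Definition best_cut (X : {set 'I_N}) f :=
  [/\ f < M, #|X :&: row_set B f| < #|X| & forall f', f' < M ->
    #|X :&: row_set B f'| < #|X| -> #|X :&: row_set B f'| <= #|X :&: row_set B f|].

Lemma tr_descend s (X : {set 'I_N}) : ok s -> N <= L -> rep s 5 X -> rg s 9 < V ->
    (X != set0 -> exists f, f < M /\ #|X :&: row_set B f| < #|X|) ->
  tr (descend a) s (180 * work) (fun s' w => w = [::] /\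
    if X == set0 then rg s' 9 = rg s 9 /\ rep s' 5 X
    else exists f, [/\ best_cut X f, rg s' 9 = rg s 9 + 1 & rep s' 5 (X :&: row_set B f)]).
Proof.
move=> oks NL h5 r9 hX.
apply: (tr_seq_le (T2 := 160 * work) (tr_card oks h5)); first by rewrite /work; clear; lia.
move=> s1 w1 ok1 fr1 [-> r3] /=.
apply: (tr_if_le (T0 := 158 * work)); first by rewrite /= /work; lia.
rewrite /= r3 cards_eq0; case: (eqVneq X set0) => X0 /=.
  apply: tr_le; first apply: tr_skip => //; last by rewrite /work; clear; lia.
  by split=> //; split=> [|j]; [rewrite fr1.1|rewrite fr1.2].
have [f0 [f0M cand0]] := hX X0.
apply: (tr_seq_le (T1 := 4) (T2 := 154 * work) (Q1 := fun s' w => w = [::] /\ s' = set_reg s1 9 (rg s 9 + 1))).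
- by apply: tr_set => //=; rewrite fr1.1 // addn1.
- by rewrite /work; clear; lia.
move=> s2 w2 ok2 _ [-> E2] /=.
apply: (tr_seq_le (T1 := 2) (T2 := 152 * work) (Q1 := fun s' w => w = [::] /\ s' = set_reg s2 10 0)).
- exact: tr_set.
- by rewrite /work; clear; lia.
move=> s3 w3 ok3 _ [-> E3] /=.
apply: (tr_seq_le (T1 := 2) (T2 := 150 * work) (Q1 := fun s' w => w = [::] /\ s' = set_reg s3 11 0)).
- exact: tr_set.
- by rewrite /work; clear; lia.
move=> s4 w4 ok4 _ [-> E4] /=.
have h54 : rep s4 5 X by move=> j; rewrite E4 E3 E2 !memE fr1.2.
have r34 : rg s4 3 = #|X| by rewrite E4 E3 E2 !memE.
have r94 : rg s4 9 = rg s 9 + 1 by rewrite E4 E3 E2 !memE.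
pose c f := #|X :&: row_set B f|.
pose I i s' (w : seq nat) := w = [::] /\
  (((forall f, f < i -> ~~ (c f < #|X|)) /\ rg s' 10 = 0) \/
   [/\ rg s' 11 < i, c (rg s' 11) < #|X|, rg s' 10 = c (rg s' 11)
     & forall f, f < i -> c f < #|X| -> c f <= rg s' 10]).
apply: (tr_seq_le (T1 := 7 + 51 * (row_start B M + M)) (T2 := 80 * work)
  (Q1 := fun s' w => rg s' 0 = M /\ I M s' w)).
- rewrite -sum_rows; apply: tr_le; first apply: (@tr_for _ _ _ _ _ _ _ _ 0 M (fun f => 42 * (#|row_set B f| + 1)) I) => //.
  + by move=> s' _; apply: ev_eM.
  + by split=> //; left; rewrite E4 E3 !memE.
  + move=> i s' w /andP[_ iM] ok' fr r0 [-> hI].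
    have rep5 : rep s' 5 X by move=> j; rewrite fr.2.
    apply: (tr_seq_le (T2 := 19 * (#|row_set B i| + 1)) (tr_count ok' rep5 r0 iM)); first by clear; lia.
    move=> s5 w5 ok5 fr5 [-> c5] /=.
    apply: (tr_if_le (T0 := 4)); first by rewrite /=; clear; lia.
    have -> : (ev s5 (Op OMul (Op OLt (Reg 2) (Reg 3)) (Op OLt (Reg 10) (Op OAdd (Reg 2) (Cst 1)))) != 0)
        = (c i < #|X|) && (rg s' 10 <= c i).
      rewrite /= c5 fr5.1 // fr5.1 // fr.1 // r34 addn1 ltnS -/(c i).
      by case: (c i < _); case: (_ <= c i).
    case: ifP => [/andP[ci lci]|nci].
      apply: (tr_seq_le (T1 := 2) (T2 := 2) (Q1 := fun s' w => w = [::] /\ s' = set_reg s5 10 (c i))) => //.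
        by apply: tr_set => //=; [exact: ok_rg ok5|rewrite c5].
      move=> s6 w6 ok6 fr6 [-> E6] /=.
      apply: (tr_weaken (Q := fun s' w => w = [::] /\ s' = set_reg s6 11 i) (T := 2)) => //.
        have r60 : rg s6 0 = i by rewrite fr6.1 // fr5.1.
        by apply: tr_set; rewrite //= r60 // (leq_trans (ltnW iM)).
      move=> s7 w7 _ _ [-> E7]; split=> //; right.
      rewrite E7 E6 !memE /=; split=> // f; rewrite ltnS leq_eqVlt => /orP[/eqP -> //|fi] cf.
      case: hI => [[hn _]|[_ _ _ hm]]; first by have := hn f fi; rewrite cf.
      exact: leq_trans (hm f fi cf) lci.
    apply: tr_le; first apply: tr_skip => //.
      split=> //; rewrite !memE /= !fr5.1 //; case: hI => [[hn r10]|[h1 h2 h3 h4]]; [left|right].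
        split=> // f; rewrite ltnS leq_eqVlt => /orP[/eqP ->|/hn //].
        by move/negbT: nci; rewrite r10 andbT.
      split=> // [|f]; first exact: ltn_trans h1 _.
      rewrite ltnS leq_eqVlt => /orP[/eqP ->|fi] cf; last exact: h4.
      by move/negbT: nci; rewrite cf /= -ltnNge => /ltnW.
    by [].
  + rewrite sum_rows big_split -big_distrr /= big_split /= -row_start_sum //.
    rewrite !sum_nat_const_nat; lia.
- by rewrite /work; clear; lia.
move=> s5 w5 ok5 fr5 [_ [-> hI]] /=.
(* A row with a proper trace exists by assumption, which excludes the alternative of the invariant
   in which none was found. *)
have [fM cut maxf] : best_cut X (rg s5 11).
  case: hI => [[hn _]|[h1 h2 h3 h4]]; first by have := hn f0 f0M; rewrite /c cand0.
  by split=> // f; rewrite -/(c f) -/(c _) -h3; apply: h4.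
have r95 : rg s5 9 = rg s 9 + 1 by rewrite fr5.1.
have h55 : rep s5 5 X by move=> j; rewrite fr5.2.
move rf : (rg s5 11) fM cut maxf => f fM cut maxf.
apply: (tr_seq_le (T1 := 17 * (N + 1)) (T2 := 62 * work)
  (Q1 := fun s' w => w = [::] /\ forall v, v < N -> ar s' 2 v = 0)).
- apply: tr_le; first apply: (@tr_fill _ _ _ 2 _ _ _ N (fun=> 0)) => //.
    by move=> s' _; apply: ev_eN.
  by rewrite /=; clear; lia.
- by rewrite /work; clear; lia.
move=> s6 w6 ok6 fr6 [-> z6] /=.
apply: (tr_seq_le (T1 := 2) (T2 := 60 * work) (Q1 := fun s' w => w = [::] /\ s' = set_reg s6 0 f)).
- by apply: tr_set; rewrite //= fr6.1 // rf // (leq_trans (ltnW fM)).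
- by rewrite /work; clear; lia.
move=> s7 w7 ok7 _ [-> E7] /=.
have h57 : rep s7 5 X by move=> j; rewrite E7 memE fr6.2.
have V0 : 0 < V by apply: leq_trans MV; apply: leq_ltn_trans fM.
apply: (tr_seq_le (T1 := 40 * (#|row_set B f| + 1)) (T2 := 18 * (N + 1))
  (Q1 := fun s' w => w = [::] /\ rep s' 2 (X :&: row_set B f))).
- apply: tr_weaken; first apply: (@tr_scatter_row _ _ f (fun v => ar s7 5 v)) => //.
  + by rewrite E7 memE.
  + move=> j; rewrite E7 memE z6 // memE fr6.2 // h55.
    by case: (j \in row_set B f); case: (j \in X).
  + by move=> v s' vN fr /= e; rewrite e fr.2.
  + by [].
  move=> s' w _ _ [-> h]; split=> // j; rewrite h E7 memE z6 // memE fr6.2 // h55 in_setI.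
  by case: (j \in row_set B f); case: (j \in X).
- have := max_card (row_set B f); rewrite card_ord /work; clear; lia.
move=> s8 w8 ok8 fr8 [-> h8] /=.
apply: tr_weaken; first apply: (@tr_fill _ _ _ 5 _ _ _ N (fun v => ar s8 2 v)) => //.
- by move=> s' _; apply: ev_eN.
- by move=> v _; apply: ok_ar ok8.
- by move=> v s' vN fr /= r5 _; rewrite r5 fr.2.
- by rewrite /=; clear; lia.
move=> s9 w9 _ fr9 [-> h9]; split=> //; exists f; split=> //.
  by rewrite fr9.1 // fr8.1 // E7 memE /= fr6.1.
by move=> j; rewrite h9 // h8.
Qed.

Lemma iota_mem (G : {set 'I_N}) :
  [seq x <- iota 0 N | x \in [seq val j | j <- enum G]] = [seq val j | j <- enum G].
Proof.
rewrite -val_enum_ord filter_map; congr map.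
rewrite [in RHS]/enum_mem -enumT; apply: eq_filter => j /=.
by rewrite mem_map ?mem_enum //; apply: val_inj.
Qed.

(** A closed set [Z] strictly between the trace and [X] would lie in a row missing some element of
    [X]. The trace of that row is proper and contains [Z], so it is larger than the best one. *)
Lemma best_cut_cover d (rho : {set 'I_N} -> nat) (X : {set 'I_N}) f :
    face_lattice d B rho -> gclosure B X = X -> best_cut X f ->
  gclosure B (X :&: row_set B f) = X :&: row_set B f /\
  rho X = (rho (X :&: row_set B f)).+1.
Proof.
move=> FL cX [fM cut maxf].
have cI : gclosure B (X :&: row_set B f) = X :&: row_set B f.
  apply/eqP; rewrite eqEsubset sub_gclosure andbT subsetI -{2}cX gclosureS ?subsetIl //=.
  by apply/subsetP => j /gclosure_rows; apply=> //; apply: subsetIr.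
split=> //; apply: (rank_cover FL) => //; first by rewrite properEcard subsetIl.
move=> Z cZ IZ; apply/negP => /properP[ZX [x xX]]; rewrite -cZ => /gclosure_rows nx.
have [g [gM Zg xg]] : exists g, [/\ g < M, Z \subset row_set B g & x \notin row_set B g].
  apply/not_existsP => h; apply: nx => g gM Zg.
  by apply/negPn/negP => xg; apply: (h g).
have Zc : Z \subset X :&: row_set B g by rewrite subsetI ZX.
have cg : #|X :&: row_set B g| < #|X|.
  apply: proper_card; rewrite properE subsetIl; apply/negP => /subsetP/(_ x xX).
  by rewrite inE (negbTE xg) andbF.
have := leq_trans (proper_card IZ) (subset_leq_card Zc).
by rewrite ltnNge maxf.
Qed.

(** An element of [X] is not in the closure of the empty set, hence is missed by some row. *)
Lemma closed_cut (X : {set 'I_N}) : gclosure B set0 = set0 -> X != set0 ->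
  exists f, f < M /\ #|X :&: row_set B f| < #|X|.
Proof.
move=> c0 /set0Pn[x xX].
have : x \notin gclosure B set0 by rewrite c0 in_set0.
move=> /gclosure_rows nx; apply/not_existsP => h; apply: nx => f fM _.
apply/negPn/negP => xf; apply: (h f); split=> //.
apply: proper_card; rewrite properE subsetIl; apply/negP => /subsetP/(_ x xX).
by rewrite inE (negbTE xf) andbF.
Qed.

Lemma tr_emit_face d (rho : {set 'I_N} -> nat) K k (s : memory) (G : {set 'I_N}) :
    ok s -> N <= L -> face_lattice d B rho -> (forall s', ev s' K = k) -> cost K <= 2 -> k < V ->
    rep s 4 G -> gclosure B G = G -> rho G <= k ->
  tr (emit a K) s (280 * ((k + 1) * work))
    (fun _ w => w = rho G :: #|G| :: [seq val j | j <- enum G]).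
Proof.
move=> oks NL FL eK cK kV h4 cG rk.
have Nw : N + 1 <= work by rewrite /work; clear; lia.
have wk : (k + 1) * work = k * work + work by rewrite mulnDl mul1n.
apply: (tr_seq_le (T1 := 18 * (N + 1)) (T2 := 262 * ((k + 1) * work)) (Q1 := fun s' w => w = [::] /\ rep s' 5 G)).
- apply: tr_weaken; first apply: (@tr_fill _ _ _ 5 _ _ _ N (fun v => ar s 4 v)) => //.
  + by move=> s' _; apply: ev_eN.
  + by move=> v _; apply: ok_ar oks.
  + by move=> v s' vN fr /= r5 _; rewrite r5 fr.2.
  + by rewrite /=; clear; lia.
  by move=> s' w _ _ [-> h]; split=> // j; rewrite h.
- by move: wk Nw; clear; lia.
move=> s1 w1 ok1 fr1 [-> h5] /=.
have h41 : rep s1 4 G by move=> j; rewrite fr1.2.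
apply: (tr_seq_le (T1 := 2) (T2 := 260 * ((k + 1) * work)) (Q1 := fun s' w => w = [::] /\ s' = set_reg s1 9 0)).
- exact: tr_set.
- by move: wk Nw; clear; lia.
move=> s2 w2 ok2 _ [-> E2] /=.
(* Register 9 plus the rank of the remaining face is constant, and the register keeps pace with the
   loop until the face is empty. After [k >= rho G] rounds, either way, register 9 equals
   [rho G]. *)
pose I i s' (w : seq nat) := w = [::] /\ exists X, [/\ rep s' 5 X, gclosure B X = X,
  rg s' 9 + rho X = rho G & rg s' 9 = i \/ X = set0].
have rho0 := rank_bot FL.
have c0 := lattice_bot FL.
apply: (tr_seq_le (T1 := 7 + k * (189 * work)) (T2 := 62 * ((k + 1) * work)) (Q1 := fun s' w => rg s' 12 = k /\ I k s' w)).
- apply: tr_le; first apply: (@tr_for _ _ _ _ _ _ _ _ 0 k (fun=> 180 * work) I) => //.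
  + exact: ltnW.
  + split=> //; exists G; rewrite E2 !memE.
    by split=> //; left.
  + move=> i s' w /andP[_ ik] ok' fr _ [-> [X [h5' cX rX hX]]].
    apply: tr_weaken; first apply: (tr_descend (X := X)) => //.
    * by apply: leq_ltn_trans kV; apply: leq_trans rk; rewrite -rX leq_addr.
    * exact: closed_cut.
    * by [].
    move=> s3 w3 _ _ [->]; case: (eqVneq X set0) => [X0 [r9 h5'']|X0 [f [cut r9 h5'']]].
      by split=> //; exists X; rewrite memE /= r9; split=> //; right.
    have [cI rI] := best_cut_cover FL cX cut.
    split=> //; exists (X :&: row_set B f); rewrite memE /= r9; split=> //.
    * by rewrite -rX rI -addnA add1n.
    * by left; case: hX => [->|X00]; [rewrite addn1|rewrite X00 eqxx in X0].
  + rewrite sum_nat_const_nat subn0 /=.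
    have : k * (180 * work + (cost K + 7)) <= k * (189 * work) by rewrite leq_mul2l /work; apply/orP; right; lia.
    lia.
- by move: wk Nw; clear; lia.
move=> s3 w3 ok3 fr3 [_ [-> [X [_ cX rX hX]]]] /=.
have h43 : rep s3 4 G by move=> j; rewrite fr3.2 // E2 memE.
have r9 : rg s3 9 = rho G.
  case: hX => [r9|X0]; last by rewrite -rX X0 rho0 addn0.
  by apply/eqP; rewrite eqn_leq {2}r9 rk andbT -rX leq_addr.
apply: (tr_seq_le (T1 := 2) (T2 := 60 * ((k + 1) * work)) (Q1 := fun s' w => w = [:: rho G] /\ s' = s3)).
- by apply: tr_emit => //=; rewrite r9.
- by move: wk Nw; clear; lia.
move=> _ _ _ _ [-> ->] /=.
apply: (tr_seq_le (T1 := 20 * (N + 1)) (T2 := 17 * (N + 1)) (tr_card ok3 h43)).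
  by move: wk Nw; clear; lia.
move=> s4 w4 ok4 fr4 [-> r3] /=.
apply: (tr_seq_le (T1 := 2) (T2 := 15 * (N + 1)) (Q1 := fun s' w => w = [:: #|G|] /\ s' = s4)).
- by apply: tr_emit => //=; rewrite r3.
- by lia.
move=> _ _ _ _ [-> ->] /=.
have h44 : rep s4 4 G by move=> j; rewrite fr4.2.
pose J i (s' : memory) w := w = [seq x <- iota 0 i | x \in [seq val j | j <- enum G]].
apply: tr_weaken; first apply: (@tr_for _ _ _ _ _ _ _ _ 0 N (fun=> 5) J) => //.
- by move=> s' _; apply: ev_eN.
- move=> i s' w /andP[_ iN] ok' fr r5 ->.
  have mi : (i \in [seq val j | j <- enum G]) = (Ordinal iN \in G).
    by rewrite -[i]/(val (Ordinal iN)) mem_map ?mem_enum //; apply: val_inj.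
  have JS : [seq x <- iota 0 i.+1 | x \in [seq val j | j <- enum G]] =
      [seq x <- iota 0 i | x \in [seq val j | j <- enum G]] ++ (if Ordinal iN \in G then [:: i] else [::]).
    by rewrite -addn1 iotaD filter_cat add0n /= mi.
  apply: (tr_if_le (T0 := 2)) => //; rewrite /= r5 fr.2 // (h44 (Ordinal iN)).
  case: (boolP (_ \in G)) JS => iG JS /=.
    apply: (tr_weaken (Q := fun _ w' => w' = [:: i]) (T := 2)) => //.
      by apply: tr_emit => //=; rewrite r5.
    by move=> s5 w5 _ _ ->; rewrite /J JS.
  apply: (tr_weaken (Q := fun _ w' => w' = [::]) (T := 1)) => //; first exact: tr_skip.
  by move=> s5 w5 _ _ ->; rewrite /J JS.
- by rewrite sum_nat_const_nat /=; lia.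
by move=> s5 w5 _ _ [_ ->]; rewrite /J iota_mem.
Qed.

End Side.

Import Order.TTheory GRing.Theory Num.Theory.

(** * Faces of a polytope given by inequalities *)

Section Entries.
Local Open Scope ring_scope.
Variables (R : realType) (k q : nat) (M : 'M[R]_(k, q)).
Implicit Types (x u : 'rV[R]_k).

Lemma value_step x u (e : R) j :
  ((x + e *: u) *m M) 0 j = (x *m M) 0 j + e * (u *m M) 0 j.
Proof. by rewrite mulmxDl -scalemxAl !mxE. Qed.

Lemma value_diff x u j : ((x - u) *m M) 0 j = (x *m M) 0 j - (u *m M) 0 j.
Proof. by rewrite mulmxBl !mxE. Qed.

(* Ratio test: follow the ray until a further inequality becomes tight. *)
Lemma shoot (b : 'rV[R]_q) x u j0 :
    (forall j, (x *m M) 0 j <= b 0 j) -> 0 < (u *m M) 0 j0 ->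
  exists t j, [/\ 0 <= t, 0 < (u *m M) 0 j, ((x + t *: u) *m M) 0 j = b 0 j
    & forall l, ((x + t *: u) *m M) 0 l <= b 0 l].
Proof.
move=> fx uj0; pose r j := (b 0 j - (x *m M) 0 j) / (u *m M) 0 j.
pose D j := 0 < (u *m M) 0 j.
have := @Order.TotalTheory.arg_minP _ R _ j0 D r uj0.
case=> j uj hmin; exists (r j), j.
have r0 : 0 <= r j by rewrite divr_ge0 ?subr_ge0 ?fx // ltW.
split=> // [|l]; rewrite value_step; first by rewrite divfK ?gt_eqF // addrC subrK.
have [u0|u0] := leP ((u *m M) 0 l) 0.
  by rewrite (le_trans _ (fx l)) // gerDl mulr_ge0_le0.
by have := hmin l u0; rewrite ler_pdivlMr // lerBrDl.
Qed.

End Entries.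

Section AffineDimension.
Local Open Scope ring_scope.
Local Open Scope classical_set_scope.
Variables (R : realType) (k : nat).
Implicit Types (G : set 'rV[R]_k) (x : 'rV[R]_k) (U : 'M[R]_k).

Lemma affine_direction_sub x x' U U' :
  [set z | (z - x <= U)%MS] = [set z | (z - x' <= U')%MS] -> (U <= U')%MS.
Proof.
move=> E; have h u : (u <= U)%MS -> (x + u - x' <= U')%MS.
  move=> uU; have : [set z | (z - x <= U)%MS] (x + u) by rewrite /= addrC addKr.
  by rewrite E.
apply/rV_subP => u uU; have := h u uU; have := h 0 (sub0mx _ _); rewrite addr0 => h0 hu.
have -> : u = (x + u - x') - (x - x') by rewrite opprB addrA subrK addrC addKr.
by rewrite addmx_sub // eqmx_opp.
Qed.

(** An affine set determines its space of directions, so the choice made by [xget] has no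
    influence. *)
Lemma affdim_rank G x U :
  aff_hull G = [set z | (z - x <= U)%MS] -> affdim G = (\rank U)%:Z.
Proof.
move=> E; rewrite /affdim; apply: xget_subset1; first by exists x, U.
move=> _ _ [x1 [U1 [E1 ->]]] [x2 [U2 [E2 ->]]]; congr Posz.
apply/eqP; rewrite eqn_leq !mxrankS //; first exact: (@affine_direction_sub x2 x1 _ _ (etrans (esym E2) E1)).
exact: (@affine_direction_sub x1 x2 _ _ (etrans (esym E1) E2)).
Qed.

(** A combination of no points has coefficient sum 0 instead of 1. The hull is thus empty and the
    default value of [xget] applies. *)
Lemma affdim0 : affdim (classical_sets.set0 : set 'rV[R]_k) = -1.
Proof.
rewrite /affdim xgetPN // => _ [x [U [E _]]].
have : aff_hull classical_sets.set0 x by rewrite E /= subrr sub0mx.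
move=> [[|r] [X [l [h l1 _]]]]; last by case: (h ord0).
by move/eqP: l1; rewrite big_ord0 eq_sym oner_eq0.
Qed.

End AffineDimension.

(** * Active inequalities, lineality spaces and covers of faces *)

Section Inequalities.
Local Open Scope ring_scope.
Variables (R : realType) (k q : nat) (M : 'M[R]_(k, q)) (b : 'rV[R]_q).
Implicit Types (x y z u w : 'rV[R]_k) (J : {set 'I_q}).

Definition feasible x := forall j, (x *m M) 0 j <= b 0 j.

Definition active x : {set 'I_q} := [set j | (x *m M) 0 j == b 0 j].

(** Columns outside [J] are zeroed rather than deleted, so that the size of the matrix does not
    depend on [J]. *)
Definition selected J : 'M[R]_(k, q) := \matrix_(i, j) (if j \in J then M i j else 0).

(** Directions along which all inequalities of [J] stay constant. For the active set of a feasible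
    point these are the directions of the face having that point in its relative interior. *)
Definition lineality J : 'M[R]_k := kermx (selected J).

Lemma mul_selected m (X : 'M[R]_(m, k)) J i j :
  (X *m selected J) i j = if j \in J then (X *m M) i j else 0.
Proof.
rewrite !mxE; case: ifP => jJ; first by apply: eq_bigr => l _; rewrite mxE jJ.
by rewrite big1 // => l _; rewrite mxE jJ mulr0.
Qed.

Lemma linealityP J (u : 'rV[R]_k) :
  reflect (forall j, j \in J -> (u *m M) 0 j = 0) (u <= lineality J)%MS.
Proof.
apply: (iffP sub_kermxP) => [h j jJ|h].
  by have := mul_selected u J 0 j; rewrite jJ h mxE.
apply/rowP => j; rewrite mul_selected [RHS]mxE; case: ifP => // jJ; exact: h.
Qed.

Lemma activeP x j : reflect ((x *m M) 0 j = b 0 j) (j \in active x).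
Proof. by rewrite inE; apply: eqP. Qed.

Lemma inactive_lt x j : feasible x -> j \notin active x -> (x *m M) 0 j < b 0 j.
Proof. by move=> /(_ j); rewrite inE lt_neqAle => -> ->. Qed.

(** Each condition holds for all sufficiently short steps, so the minimum of the finitely many
    thresholds works for all. *)
Lemma common_step (I : finType) (Q : I -> R -> Prop) :
    (forall i, exists2 e, 0 < e & forall e', 0 < e' <= e -> Q i e') ->
  exists2 e, 0 < e & forall i, Q i e.
Proof.
move=> h.
suff [e e0 he] : exists2 e, 0 < e & forall i, i \in enum I -> forall e', 0 < e' <= e -> Q i e'.
  by exists e => // i; apply: he; rewrite ?mem_enum // e0 lexx.
elim: (enum I) => [|i s [e e0 IH]]; first by exists 1.
have [e1 e10 he1] := h i.
exists (Num.min e e1); first by rewrite lt_min e0.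
move=> l; rewrite inE => /orP[/eqP ->|ls] e' /andP[e'0]; rewrite le_min => /andP[h1 h2].
  by apply: he1; rewrite e'0.
by apply: IH => //; rewrite e'0.
Qed.

(** Inactive inequalities tolerate a short step, and active ones that decrease along [u] become
    inactive. *)
Lemma small_step x u : feasible x -> (forall j, j \in active x -> (u *m M) 0 j <= 0) ->
  exists2 e, 0 < e & feasible (x + e *: u) /\
    active (x + e *: u) = [set j in active x | (u *m M) 0 j == 0].
Proof.
move=> fx hu.
pose Q j (e : R) := if j \in active x then true
  else (x *m M) 0 j + e * (u *m M) 0 j < b 0 j.
have [|e e0 he] := @common_step _ Q.
  move=> j; have [jx|jx] := boolP (j \in active x); first by exists 1; rewrite // /Q jx.
    rewrite /Q (negbTE jx).
  have lt_j := inactive_lt fx jx.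
  have [u0|u0] := leP ((u *m M) 0 j) 0.
    by exists 1 => // e' /andP[e'0 _]; apply: (le_lt_trans _ lt_j); rewrite gerDl mulr_ge0_le0 // ltW.
  (* The factor 2 uses at most half of the slack, which keeps the inequality strict. *)
  exists ((b 0 j - (x *m M) 0 j) / (2 * (u *m M) 0 j)).
    by rewrite divr_gt0 ?mulr_gt0 ?subr_gt0.
  move=> e' /andP[e'0]; rewrite ler_pdivlMr ?mulr_gt0 // => h.
  by nra.
exists e => //; split.
  move=> j; rewrite value_step; have := he j; rewrite /Q.
  case: ifP => [/[dup] /activeP -> /hu uj _|_]; last by move/ltW.
  by rewrite gerDl mulr_ge0_le0 // ltW.
apply/setP => j; rewrite [LHS]inE [RHS]inE value_step.
have := he j; rewrite /Q; case: ifP => [/activeP -> _|_ /lt_eqF] //=.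
by rewrite -subr_eq0 addrC addKr mulf_eq0 gt_eqF.
Qed.

Lemma active_midpoint x y : feasible x -> feasible y ->
  feasible (2^-1 *: (x + y)) /\ active (2^-1 *: (x + y)) = active x :&: active y.
Proof.
move=> fx fy.
have E j : (2^-1 *: (x + y) *m M) 0 j = 2^-1 * ((x *m M) 0 j + (y *m M) 0 j).
  by rewrite -scalemxAl mulmxDl !mxE.
split=> [j|]; first by rewrite E; have := fx j; have := fy j; lra.
apply/setP => j; rewrite !inE E; have := fx j; have := fy j => h1 h2.
apply/eqP/andP => [h|[/eqP -> /eqP ->]]; last by lra.
by split; apply/eqP; lra.
Qed.

Definition active_face J : set 'rV[R]_k := [set x | feasible x /\ J \subset active x].

(** The sum of the inequalities of [J] is valid, and it is tight only where each summand is. *)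
Lemma active_face_face J : faces [set x | feasible x] (active_face J).
Proof.
pose c : 'cV[R]_k := \col_i \sum_(j in J) M i j.
have cE x : (x *m c) 0 0 = \sum_(j in J) (x *m M) 0 j.
  rewrite mxE; under eq_bigr do rewrite mxE mulr_sumr.
  by rewrite exchange_big; apply: eq_bigr => j _; rewrite mxE.
exists c, (\sum_(j in J) b 0 j); split=> [x fx|].
  by rewrite cE; apply: ler_sum => j _; apply: fx.
apply/seteqP; split=> x /= [fx]; rewrite cE.
  move=> /subsetP sJ; split=> //; apply: eq_bigr => j jJ; exact/activeP/sJ.
move=> /esym/eqP; rewrite -subr_eq0 -sumrB psumr_eq0; last by move=> j _; rewrite subr_ge0; apply: fx.
move=> /allP h; split=> //; apply/subsetP => j jJ; apply/activeP/esym/eqP.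
by rewrite -subr_eq0; have := h j (mem_index_enum j); rewrite jJ.
Qed.

(** From [x] a short step directly away from [z] stays feasible. If the functional of [G] were
    smaller at [z] than at [x], this step would exceed its maximum. *)
Lemma face_active G x z : faces [set x | feasible x] G -> G x -> feasible z ->
  active x \subset active z -> G z.
Proof.
move=> [c [beta [hc ->]]] [fx xc] fz /subsetP sxz; split=> //.
have [|e e0 [fe _]] := @small_step x (x - z) fx.
  by move=> j jx; rewrite value_diff (activeP _ _ jx) (activeP _ _ (sxz _ jx)) subrr.
have := hc _ fe; have := hc _ fz; rewrite value_step value_diff xc => h1 h2.
by nra.
Qed.

Lemma face_sub G x : faces [set x | feasible x] G -> G x -> feasible x.
Proof. by move=> [c [beta [_ ->]]] []. Qed.

(* A point with fewest active inequalities lies in the relative interior. *)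
Lemma face_interior G x : faces [set x | feasible x] G -> G x ->
  exists2 y, G y & forall z, G z -> active y \subset active z.
Proof.
move=> fG; have [r] := ubnP #|active x|; elim: r x => // r IH x; rewrite ltnS => hx Gx.
have [h|] := pselect (forall z, G z -> active x \subset active z); first by exists x.
move=> /existsNP[z /not_implyP[Gz /negP nz]].
have [fm am] := active_midpoint (face_sub fG Gx) (face_sub fG Gz).
apply: (IH (2^-1 *: (x + z))).
  rewrite am (leq_trans _ hx) // proper_card // properE subsetIl /=.
  by apply: contra nz => /subset_trans; apply; apply: subsetIr.
case: fG Gx Gz fm {am nz IH hx} => c [beta [hc ->]] [fx xc] [fz zc] fm; split=> //.
suff -> : (2^-1 *: (x + z) *m c) 0 0 = 2^-1 * ((x *m c) 0 0 + (z *m c) 0 0) by rewrite xc zc; lra.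
by rewrite -scalemxAl mulmxDl !mxE.
Qed.

Lemma face_eq_active G y : faces [set x | feasible x] G -> G y ->
  (forall z, G z -> active y \subset active z) -> G = active_face (active y).
Proof.
move=> fG Gy h; apply/seteqP; split=> x; last by move=> [fx]; apply: face_active fG Gy fx.
by move=> Gx; split; [apply: face_sub Gx | apply: h].
Qed.

Lemma lineality_lt y h : feasible y -> feasible h -> active y \proper active h ->
  [/\ (y - h <= lineality (active y))%MS, ~~ (y - h <= lineality (active h))%MS,
      (lineality (active h) <= lineality (active y))%MS &
      (\rank (lineality (active h)) < \rank (lineality (active y)))%N].
Proof.
move=> fy fh /properP[/subsetP syh [j jh jy]].
have E l := value_diff M y h l.
have h1 : (y - h <= lineality (active y))%MS.
  by apply/linealityP => l ly; rewrite E (activeP _ _ ly) (activeP _ _ (syh _ ly)) subrr.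
have h2 : ~~ (y - h <= lineality (active h))%MS.
  apply/negP => /linealityP/(_ j jh)/eqP; rewrite E (activeP _ _ jh) subr_eq0.
  by rewrite lt_eqF // inactive_lt.
have h3 : (lineality (active h) <= lineality (active y))%MS.
  apply/rV_subP => u /linealityP hu; apply/linealityP => l /syh; exact: hu.
split=> //; apply: rank_ltmx; rewrite /ltmx h3 /=.
by apply: contra h2; apply: submx_trans.
Qed.

(** The claim is that the lineality space at [y] is spanned by that at [h] and [u0 = y - h].
    Otherwise some [w] in it lies outside this span. Tilting [u0] along [w] until another inequality
    active at [h] becomes tight gives a direction [u1], and a short step from [h] along [u1] reaches
    a point whose active set lies strictly between the two. *)
Lemma cover_rank y h : feasible y -> feasible h -> active y \proper active h ->
    (forall z, feasible z -> active y \proper active z -> ~~ (active z \proper active h)) ->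
  \rank (lineality (active y)) = (\rank (lineality (active h))).+1.
Proof.
move=> fy fh yh hz; have [u0y u0h Lhy ltL] := lineality_lt fy fh yh.
have syh := subsetP (proper_sub yh).
apply/eqP; rewrite eqn_leq ltL andbT.
have [/mxrankS|/row_subPn[i]] := boolP (lineality (active y) <= lineality (active h) + (y - h))%MS.
  move/leq_trans; apply; rewrite (leq_trans (mxrank_adds_leqif _ _)) //.
  by have := rank_leq_row (y - h); move: (\rank (y - h)); lia.
set w := row i _ => wW; exfalso.
have wy : (w <= lineality (active y))%MS by apply: row_sub.
(* Some inequality active at [h] is not constant along [w]; replacing [w] by its negative makes it
   increase. *)
wlog [j1 wj1] : w wW wy / exists j, 0 < (w *m selected (active h)) 0 j.
  move=> hwlog.
  have : ~~ (w <= lineality (active h))%MS.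
    by apply: contra wW => /submx_trans; apply; apply: addsmxSl.
  move=> /linealityP/existsNP[j /not_implyP[jh /eqP wj]].
  have [w0|w0] := ltP 0 ((w *m M) 0 j).
    by apply: (hwlog w) => //; exists j; rewrite mul_selected jh.
  apply: (hwlog (- w)); rewrite ?eqmx_opp //.
  by exists j; rewrite mul_selected jh mulNmx mxE oppr_gt0 lt_neqAle wj.
have cone : (forall j, ((y - h) *m selected (active h)) 0 j <= (0 : 'rV[R]_q) 0 j).
  move=> j; rewrite mul_selected [X in _ <= X]mxE; case: ifP => // jh.
  by rewrite value_diff (activeP _ _ jh) subr_le0; apply: fy.
move: (y - h) u0y u0h cone wW => u0 u0y u0h cone wW.
(* The ratio test is applied to the homogeneous system of the inequalities active at [h], that is,
   inside the cone of feasible directions at [h]. *)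
have [t [j [t0 wj j1act cone1]]] := shoot cone wj1.
set u1 := u0 + t *: w in cone1 j1act.
have [|e e0 [fe ae]] := @small_step h u1 fh.
  by move=> l lh; have := cone1 l; rewrite mul_selected lh [X in _ <= X]mxE.
move: wj j1act; rewrite !mul_selected [X in _ -> _ = X -> _]mxE; case: ifP => [jh wj u1j|_]; last by rewrite ltxx.
have /linealityP u1y : (u1 <= lineality (active y))%MS by rewrite addmx_sub ?scalemx_sub.
(* The stopping inequality [j] is new: it increases along [w], while all those active at [y] are
   constant along [w]. *)
have yz : active y \proper active (h + e *: u1).
  rewrite properE; apply/andP; split.
    by apply/subsetP => l ly; rewrite ae inE syh //= u1y.
  apply/subsetPn; exists j; first by rewrite ae inE jh u1j /=.
  by apply/negP => /(linealityP _ _ wy); apply/eqP; rewrite gt_eqF.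
have /negP[] := hz _ fe yz; rewrite properE; apply/andP; split.
  by apply/subsetP => l; rewrite ae inE => /andP[].
apply/negP => /subsetP hh.
have u1h : (u1 <= lineality (active h))%MS.
  by apply/linealityP => l /hh; rewrite ae inE => /andP[_ /eqP].
(* If the new active set were all of that at [h], then [u1] would be in the lineality space at [h].
   For [t = 0] this contradicts the choice of [u0], and otherwise [w] is a combination of [u1] and
   [u0]. *)
case: (eqVneq t 0) => [t00|tn0].
  by move: u1h; rewrite /u1 t00 scale0r addr0 (negbTE u0h).
move/negP: wW; apply.
have -> : w = t^-1 *: (u1 - u0) by rewrite /u1 addrC addKr scalerA mulVf // scale1r.
apply/scalemx_sub/addmx_sub; first by apply: (submx_trans u1h); apply: addsmxSl.
by rewrite eqmx_opp addsmxSr.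
Qed.

(** The point [y] is in the relative interior of this face, so a short step along any lineality
    direction stays inside it. *)
Lemma aff_hull_active_face y : feasible y ->
  aff_hull (active_face (active y)) = [set z | (z - y <= lineality (active y))%MS]%classic.
Proof.
move=> fy; apply/seteqP; split=> z /=.
  move=> [r [X [l [hX l1 ->]]]]; apply/linealityP => j jy.
  rewrite value_diff (activeP _ _ jy) -mulmxA [X in X - _]mxE.
  have E i : (X *m M) i j = b 0 j.
    have [_ /subsetP/(_ _ jy)/activeP <-] := hX i.
    by rewrite -row_mul [RHS]mxE.
  by under eq_bigr do rewrite E; rewrite -mulr_suml l1 mul1r subrr.
move=> zy; have [|e e0 [fe ae]] := @small_step y (z - y) fy.
  by move=> j jy; rewrite (linealityP _ _ zy j jy).
(* The point [z] lies on the line through [y] and [y + e *: (z - y)], with coefficients [1 - e^-1]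
   and [e^-1]. *)
exists (1 + 1)%N, (col_mx y (y + e *: (z - y))), (row_mx (1 - e^-1)%:M e^-1%:M); split.
- move=> i; case: (split_ordP i) => i1 ->; first by rewrite rowKu row_id; split.
  rewrite rowKd row_id; split=> //; apply/subsetP => j jy; rewrite ae inE jy.
  by rewrite (linealityP _ _ zy) /=.
- by rewrite big_split_ord !big_ord1 /= row_mxEl row_mxEr !mxE eqxx !mulr1n subrK.
- rewrite mul_row_col !mul_scalar_mx scalerDr scalerA mulVf ?gt_eqF // scale1r.
  by rewrite scalerBl scale1r addrA subrK addrC subrK.
Qed.

Lemma affdim_active_face y : feasible y ->
  affdim (active_face (active y)) = (\rank (lineality (active y)))%:Z.
Proof. by move=> fy; apply: affdim_rank (aff_hull_active_face fy). Qed.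

Hypothesis bP : bounded [set x | feasible x].

Lemma bounded_ray x u : feasible x -> u != 0 -> exists j, 0 < (u *m M) 0 j.
Proof.
move=> fx /eqP/rowP/existsNP[i /eqP]; rewrite mxE => ui.
apply: contrapT => /forallNP h; case: bP => B hB.
have fu t : 0 <= t -> feasible (x + t *: u).
  move=> t0 j; rewrite value_step (le_trans _ (fx j)) // gerDl mulr_ge0_le0 //.
  by rewrite leNgt; apply/negP/h.
have B0 : 0 <= B by rewrite (le_trans _ (hB _ fx i)).
(* This step length moves coordinate [i] by [2 * B + 1], while two points of the polytope differ
   there by at most [2 * B]. *)
have t0 : 0 <= (2 * B + 1) / `|u 0 i| by rewrite divr_ge0 // ?addr_ge0 ?mulr_ge0.
have := hB _ (fu _ t0) i; have := hB _ fx i; rewrite !mxE => h1 h2.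
have : `|(2 * B + 1) / `|u 0 i| * u 0 i| <= B + B.
  move: (_ / _ * _) h2 => a; move: h1; rewrite !ler_norml => /andP[? ?] /andP[? ?].
  by apply/andP; split; lra.
rewrite normrM ger0_norm // divfK ?normr_eq0 //; lra.
Qed.

Lemma vertex_active x : feasible x -> \rank (lineality (active x)) = 0%N ->
  active_face (active x) = [set x]%classic.
Proof.
move=> fx /eqP; rewrite mxrank_eq0 => /eqP L0; apply/seteqP; split=> z /= [].
  move=> fz /subsetP sz; apply/eqP; rewrite -subr_eq0 -submx0 -L0.
  apply/linealityP => j jx; rewrite value_diff (activeP _ _ jx).
  by rewrite (activeP _ _ (sz _ jx)) subrr.
by move=> ->; split.
Qed.

(** Follow a lineality direction along which [c] does not increase until a further inequality
    becomes tight; the number of inactive inequalities drops. With [c = 0] this just produces a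
    vertex. *)
Lemma vertex_below x (c : 'cV[R]_k) : feasible x ->
  exists z, [/\ feasible z, active x \subset active z,
    \rank (lineality (active z)) = 0%N & (z *m c) 0 0 <= (x *m c) 0 0].
Proof.
have [r] := ubnP (q - #|active x|); elim: r x => // r IH x; rewrite ltnS => hr fx.
case: (eqVneq (\rank (lineality (active x))) 0%N) => [L0|]; first by exists x.
rewrite -lt0n => L0.
have [u un0 uL] : exists2 u : 'rV_k, u != 0 & (u <= lineality (active x))%MS.
  have : ~~ (lineality (active x) <= (0 : 'M[R]_k))%MS.
    by rewrite submx0 -mxrank_eq0 -lt0n.
  move/row_subPn => [i]; rewrite submx0 => hi; exists (row i (lineality (active x))) => //.
  exact: row_sub.
wlog uc : u un0 uL / (u *m c) 0 0 <= 0.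
  move=> hwlog; have [uc|uc] := leP ((u *m c) 0 0) 0; first exact: (hwlog u).
  apply: (hwlog (- u)); rewrite ?oppr_eq0 ?eqmx_opp //.
  by rewrite mulNmx mxE oppr_le0 ltW.
have [j0 uj0] := bounded_ray fx un0.
have [t [j [t0 uj hj fz]]] := shoot fx uj0.
have sxz : active x \subset active (x + t *: u).
  apply/subsetP => l lx; apply/activeP; rewrite value_step (activeP _ _ lx).
  by rewrite (linealityP _ _ uL) // mulr0 addr0.
have jx : j \notin active x.
  by apply/negP => /(linealityP _ _ uL)/eqP; rewrite gt_eqF.
have lt_act : (#|active x| < #|active (x + t *: u)|)%N.
  apply/proper_card/properP; split=> //; exists j => //; exact/activeP.
have [||z [fz' sz rz zc]] := IH (x + t *: u) => //.
  have := max_card (active (x + t *: u)); rewrite card_ord; lia.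
exists z; split=> //; first exact: subset_trans sz.
by rewrite (le_trans zc) // value_step gerDl mulr_ge0_le0.
Qed.

(** For [x] in [G], a vertex of [G] on which the functional of [H] is at most its value at [x] lies
    in [H]. So the value at [x] is already maximal. *)
Lemma face_sub_vertices G H :
    faces [set x | feasible x] G -> faces [set x | feasible x] H ->
    (forall x, vertices [set x | feasible x] x -> G x -> H x) ->
  (G `<=` H)%classic.
Proof.
move=> fG fH hv x Gx; case: (fH) => c [beta [hc HE]].
have fx := face_sub fG Gx; rewrite HE; split=> //.
apply/eqP; rewrite eq_le hc //=.
have [z [fz sxz rz zc]] := vertex_below (c) fx.
have Gz := face_active fG Gx fz sxz.
have : H z by apply: hv => //; rewrite /vertices /= -vertex_active //; apply: active_face_face.
by rewrite HE => -[_ <-].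
Qed.

Lemma face_cases G : faces [set x | feasible x] G ->
  G = classical_sets.set0 \/ exists y, [/\ feasible y, G y,
    (forall z, G z -> active y \subset active z) & G = active_face (active y)].
Proof.
move=> fG; have [[x Gx]|G0] := pselect (exists x, G x); last first.
  by left; apply/seteqP; split=> // x Gx; apply: G0; exists x.
right; have [y Gy hy] := face_interior fG Gx.
by exists y; split=> //; [apply: face_sub Gy|apply: face_eq_active].
Qed.

Lemma affdim_face_cover G H :
    faces [set x | feasible x] G -> faces [set x | feasible x] H ->
    (H `<=` G)%classic -> H <> G ->
    (forall F, faces [set x | feasible x] F -> (H `<=` F)%classic -> (F `<=` G)%classic ->
       F = H \/ F = G) ->
  affdim G = affdim H + 1.
Proof.
move=> fG fH HG nHG hF; case: (face_cases fH) => [H0|[h [fh Hh hh HE]]].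
  (* Over the empty face, [G] contains a vertex, and the cover hypothesis identifies [G] with it:
     dimension 0 against -1. *)
  case: (face_cases fG) => [G0|[y [fy Gy hy GE]]]; first by case: nHG; rewrite H0 G0.
  have [z [fz syz rz _]] := vertex_below (0 : 'cV_k) fy.
  have Gz := face_active fG Gy fz syz.
  have fF := active_face_face (active z).
  case: (hF _ fF); first by rewrite H0.
  - by move=> x; rewrite vertex_active // => ->.
  - by rewrite vertex_active // H0 => E; have : [set z]%classic z by []; rewrite E.
  by move=> <-; rewrite affdim_active_face // rz H0 affdim0 addNr.
case: (face_cases fG) => [G0|[y [fy Gy hy GE]]]; first by move/HG: Hh; rewrite G0.
have syh : active y \proper active h.
  rewrite properEneq hy ?andbT; last exact: HG.
  by apply/eqP => E; apply: nHG; rewrite HE GE E.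
suff rE : \rank (lineality (active y)) = (\rank (lineality (active h))).+1.
  rewrite HE GE (affdim_active_face fy) (affdim_active_face fh) rE.
  by rewrite -addn1 PoszD.
apply: (cover_rank fy fh syh) => z fz syz; apply/negP => szh.
case: (hF _ (active_face_face (active z))).
- rewrite HE => w [fw sw]; split=> //; exact: subset_trans (proper_sub szh) sw.
- rewrite GE => w [fw sw]; split=> //; exact: subset_trans (proper_sub syz) sw.
- move=> E; have : active_face (active z) z by split.
  by rewrite E => /hh; apply/negP; case/andP: szh.
- move=> E; move: Gy; rewrite -E => -[_]; apply/negP; by case/andP: syz.
Qed.

Hypothesis irredundant : forall j, exists2 z : 'rV[R]_k,
  forall l, l != j -> (z *m M) 0 l <= b 0 l & b 0 j < (z *m M) 0 j.

(** The segment from the relative interior point [y] to a point violating only inequality [j]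
    crosses the hyperplane of [j] where all other inequalities inactive at [y] are still strict. *)
Lemma facet_point y j : feasible y -> (forall z, feasible z -> active y \subset active z) ->
  j \notin active y -> exists2 p, feasible p & active p = j |: active y.
Proof.
move=> fy hy jy; have [z hz zj] := irredundant j; have yj := inactive_lt fy jy.
have d0 : 0 < ((z - y) *m M) 0 j by rewrite value_diff subr_gt0 (lt_trans yj).
pose s := (b 0 j - (y *m M) 0 j) / ((z - y) *m M) 0 j.
have s0 : 0 < s by rewrite divr_gt0 ?subr_gt0.
have s1 : s < 1 by rewrite ltr_pdivrMr // mul1r value_diff ltrD2r.
have pj : ((y + s *: (z - y)) *m M) 0 j = b 0 j.
  by rewrite value_step divfK ?gt_eqF // addrC subrK.
have fp : feasible (y + s *: (z - y)).
  move=> l; case: (eqVneq l j) => [->|lj]; first by rewrite pj.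
  by rewrite value_step value_diff; have := fy l; have := hz l lj; nra.
exists (y + s *: (z - y)) => //; apply/eqP; rewrite eqEsubset; apply/andP; split; last first.
  by rewrite subUset hy // andbT sub1set; apply/activeP.
apply/subsetP => l lp; rewrite in_setU1; case: eqVneq => //= lj.
apply: contraTT lp => ly; have yl := inactive_lt fy ly; rewrite inE value_step value_diff.
by rewrite lt_eqF //; have := hz l lj; nra.
Qed.

(** If [G] is nonempty, some inequality active on all of [G] is inactive at [x] and yields the
    facet. If [G] is empty, any inequality inactive at [x] will do, and boundedness provides one as
    soon as there is a second feasible point. *)
Lemma facet_separates G x : faces [set x | feasible x] G -> feasible x -> ~ G x ->
  exists F, [/\ faces [set x | feasible x] F,
    affdim F = affdim [set x | feasible x]%classic - 1, (G `<=` F)%classic & ~ F x].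
Proof.
move=> fG fx nGx.
have fP : faces [set x | feasible x] [set x | feasible x]%classic.
  by exists 0, 0; split=> [z _|]; [rewrite mulmx0 mxE|apply/seteqP; split=> z //= fz; [rewrite mulmx0 mxE|case: fz]].
have [y fy hy] := face_interior fP fx.
have PE := face_eq_active fP fy hy.
(* The active set of [p] has a single element more than that of [y], so nothing fits strictly
   between and [cover_rank] applies. *)
have facet j : j \notin active y -> exists p, [/\ feasible p, active p = j |: active y &
    affdim (active_face (active p)) = affdim [set x | feasible x]%classic - 1].
  move=> jy; have [p fp ap] := facet_point fy hy jy.
  exists p; split=> //; rewrite [in RHS]PE (affdim_active_face fy) (affdim_active_face fp).
  have yp : active y \proper active p.
    by apply/properP; split; [apply: hy|exists j => //; rewrite ap setU11].
  suff rE : \rank (lineality (active y)) = (\rank (lineality (active p))).+1.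
    by rewrite rE -addn1 PoszD addrK.
  apply: (cover_rank fy fp yp) => z fz /proper_card lt1; apply/negP => /proper_card; rewrite ap cardsU1 jy; lia.
case: (face_cases fG) => [G0|[g [fg Gg hg GE]]]; last first.
  have /subsetPn[j jg jx] : ~~ (active g \subset active x).
    by apply/negP => h; apply: nGx; rewrite GE.
  have [|p [fp ap dp]] := facet j; first by apply: contra jx; apply/subsetP/hy.
  exists (active_face (active p)); split=> //; first exact: active_face_face.
    rewrite GE => w [fw sw]; split=> //; rewrite ap subUset hy // andbT sub1set.
    exact: (subsetP sw).
  by rewrite ap => -[_ /subsetP/(_ j)]; rewrite setU11 (negbTE jx) => /(_ isT).
(* When [x] is the only feasible point, the empty face is itself the facet, of dimension 0 - 1. *)
have [[x' [fx' xx']]|only_x] := pselect (exists x', feasible x' /\ x' <> x); last first.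
  exists G; rewrite G0 affdim0; split=> //; first by rewrite -G0.
  suff -> : [set x | feasible x]%classic = active_face (active x).
    rewrite affdim_active_face // (_ : \rank _ = 0%N) ?sub0r //.
    have [z [fz _ rz _]] := vertex_below (0 : 'cV_k) fx.
    suff <- : z = x by [].
    by apply: contrapT => zx; apply: only_x; exists z.
  apply/seteqP; split=> z //=; last by case.
  move=> fz; suff -> : z = x by split.
  by apply: contrapT => zx; apply: only_x; exists z.
have [|j uj] := @bounded_ray x (x' - x) fx; first by rewrite subr_eq0; apply/eqP.
have jx : j \notin active x.
  apply/negP => /activeP xj; move: uj; rewrite value_diff xj subr_gt0 ltNge.
  by rewrite fx'.
have [|p [fp ap dp]] := facet j; first by apply: contra jx; apply/subsetP/hy.
exists (active_face (active p)); split=> //; first exact: active_face_face.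
  by rewrite G0.
by rewrite ap => -[_ /subsetP/(_ j)]; rewrite setU11 (negbTE jx) => /(_ isT).
Qed.

End Inequalities.

Section Redundancy.
Local Open Scope ring_scope.
Variables (R : realType) (k : nat).

(** In a system with the fewest inequalities, if no point violated [j] alone, then column [j] could
    be deleted without changing the solutions. *)
Lemma polyhedron_irredundant (P : set 'rV[R]_k) : polyhedron P ->
  exists q (M : 'M[R]_(k, q)) (b : 'rV[R]_q),
    P = [set x | feasible M b x]%classic /\
    forall j, exists2 z : 'rV[R]_k, forall l, l != j -> (z *m M) 0 l <= b 0 l & b 0 j < (z *m M) 0 j.
Proof.
move=> [q0 [M0 [b0 E0]]].
pose D q := `[< exists (M : 'M[R]_(k, q)) b, P = [set x | feasible M b x]%classic >].
have exD : exists q, D q by exists q0; apply/asboolP; exists M0, b0.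
case: (ex_minnP exD) => q /asboolP[M [b E]] hmin; exists q, M, b; split=> // j.
apply: contrapT => nz.
have : (q <= q.-1)%N.
  apply: hmin; apply/asboolP; exists (col' j M), (\row_l b 0 (lift j l)).
  have C x l : (x *m col' j M) 0 l = (x *m M) 0 (lift j l).
    by rewrite !mxE; apply: eq_bigr => i _; rewrite mxE.
  rewrite E; apply/seteqP; split=> x /= fx l; first by rewrite C mxE; apply: fx.
  have [x' ->|->] := unliftP j l; first by have := fx x'; rewrite C mxE.
  rewrite leNgt; apply/negP => xj; apply: nz; exists x => // l'.
  case: (unliftP j l') => [l'' -> _|->]; last by rewrite eqxx.
  by have := fx l''; rewrite C mxE.
by have := ltn_ord j; lia.
Qed.

End Redundancy.

(** * The faces of a polytope as closed sets of its incidence matrix *)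

Section FaceLattice.
Local Open Scope ring_scope.
Variables (R : realType) (k d : nat) (P : set 'rV[R]_k) (n m : nat).
Variables (v : 'I_n -> 'rV[R]_k) (f : 'I_m -> set 'rV[R]_k) (A : 'M[bool]_(m, n)).
Hypotheses (PP : polytope d P) (HA : vf_incidence d P v f A).

(** The conjunct [P x] makes a set contained in no facet yield [P] itself. *)
Definition face_of (X : {set 'I_n}) : set 'rV[R]_k :=
  [set x | P x /\ forall i, i \in polar A X -> f i x]%classic.

(** The absolute value loses nothing, because faces have dimension at least -1; see
    [affdim_face_of]. *)
Definition rank_of (X : {set 'I_n}) : nat := `|(affdim (face_of X) + 1)%R|%N.

Lemma facesI G H : faces P G -> faces P H -> faces P (G `&` H)%classic.
Proof.
move=> [c [b [h ->]]] [c' [b' [h' ->]]]; exists (c + c'), (b + b'); split.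
  by move=> x Px; rewrite mulmxDr mxE lerD ?h ?h'.
apply/seteqP; split=> x /=; first by move=> [[Px e] [_ e']]; rewrite mulmxDr mxE e e'.
move=> [Px]; rewrite mulmxDr mxE => e; have := h _ Px; have := h' _ Px => l l'.
by split; split=> //; lra.
Qed.

Lemma faceT : faces P P.
Proof.
by exists 0, 0; split=> [x _|]; [|apply/seteqP; split=> x /=; [|by case]]; rewrite mulmx0 mxE.
Qed.

Lemma face0 : faces P classical_sets.set0.
Proof.
exists 0, 1; split=> [x _|]; first by rewrite mulmx0 mxE.
by apply/seteqP; split=> x //= [_]; rewrite mulmx0 mxE => /eqP; rewrite eq_sym oner_eq0.
Qed.

Lemma facet_face i : faces P (f i) /\ affdim (f i) = d%:Z - 1.
Proof. by case: HA => _ [+ _ _] _ => /(_ i Logic.I). Qed.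

Lemma face_of_face X : faces P (face_of X).
Proof.
have h (s : seq 'I_m) : faces P [set x | P x /\ forall i, i \in s -> f i x]%classic.
  elim: s => [|i s IH].
    rewrite (_ : [set x | _]%classic = P); first exact: faceT.
    by apply/seteqP; split=> x //=; case.
  have := facesI (facet_face i).1 IH; congr faces; apply/seteqP; split=> x /=.
    move=> [fx [Px hx]]; split=> // l; rewrite inE => /orP[/eqP ->//|]; exact: hx.
  move=> [Px hx]; split; first by apply: hx; rewrite inE eqxx.
  by split=> // l ls; apply: hx; rewrite inE ls orbT.
have := h (enum (polar A X)); congr faces; apply/seteqP; split=> x /= [Px hx].
  by split=> // i iX; apply: hx; rewrite mem_enum.
by split=> // i; rewrite mem_enum; apply: hx.
Qed.

Lemma vertex_in j : P (v j).
Proof.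
case: HA => -[+ _ _] _ _ => /(_ j Logic.I) [c [b [_ E]]].
by have : [set v j]%classic (v j) by []; rewrite E => -[].
Qed.

Lemma vertex_surj x : vertices P x -> exists j, v j = x.
Proof. by case: HA => -[_ _ +] _ _ => /(_ x) h /h[j _ <-]; exists j. Qed.

Lemma mem_vset G j : reflect (G (v j)) (j \in vset v G).
Proof. by rewrite inE; apply: asboolP. Qed.

Lemma vset_face_of X : vset v (face_of X) = gclosure A X.
Proof.
case: (HA) => _ _ hA; apply/setP => j; apply/mem_vset/mem_gclosure => [[_ h] i hi|h].
  by apply/hA/h/polarP.
by split=> [|i /polarP /h /hA //]; apply: vertex_in.
Qed.

Lemma vset_subset G H : faces P G -> faces P H -> vset v G \subset vset v H -> (G `<=` H)%classic.
Proof.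
case: PP => /polyhedron_irredundant[q [M [b [E _]]]]; rewrite E => bP _ fG fH sub.
apply: (face_sub_vertices bP fG fH) => x; rewrite -E => /vertex_surj[j <-] Gj.
by apply/mem_vset/(subsetP sub)/mem_vset.
Qed.

Lemma vset_inj G H : faces P G -> faces P H -> vset v G = vset v H -> G = H.
Proof. by move=> fG fH E; apply/seteqP; split; apply: vset_subset; rewrite ?E. Qed.

Lemma vset_sub G H : (G `<=` H)%classic -> vset v G \subset vset v H.
Proof. by move=> GH; apply/subsetP => j /mem_vset/GH/mem_vset. Qed.

(** A vertex outside [G] is missed by some facet containing [G], hence is not in the closure. *)
Lemma vset_closed G : faces P G -> gclosure A (vset v G) = vset v G.
Proof.
case: (PP) => /polyhedron_irredundant[q [M [b [E irr]]]] bP aP fG.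
case: (HA) => _ [_ _ surj] hA.
apply/eqP; rewrite eqEsubset sub_gclosure andbT; apply/subsetP => j /mem_gclosure h.
apply/mem_vset; apply: contrapT => nG.
have := @facet_separates R k q M b; rewrite -E => /(_ bP irr G (v j) fG) [].
- by have := vertex_in j; rewrite E.
- by [].
move=> F [fF dF GF]; have [|i _ fi] := surj F; first by split=> //; rewrite dF aP.
rewrite -fi => nF; apply/nF/hA/h => l /mem_vset Gl; apply/hA; rewrite fi; exact: GF.
Qed.

Lemma face_of_vset G : faces P G -> face_of (vset v G) = G.
Proof.
move=> fG; apply: vset_inj => //; first exact: face_of_face.
by rewrite vset_face_of vset_closed.
Qed.

Lemma affdim_face_of X : affdim (face_of X) = (rank_of X)%:Z - 1.
Proof.
suff : -1 <= affdim (face_of X) by rewrite /rank_of; lia.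
case: PP => /polyhedron_irredundant[q [M [b [E _]]]] bP _.
have := face_of_face X; rewrite E => /face_cases[->|[y [fy _ _ ->]]].
  by rewrite affdim0.
by rewrite affdim_active_face.
Qed.

Lemma polytope_face_lattice : face_lattice d A rank_of.
Proof.
have vset0 : vset v classical_sets.set0 = set0.
  by apply/setP => j; rewrite in_set0; apply/negbTE/negP => /mem_vset.
have vsetT : vset v P = setT.
  by apply/setP => j; rewrite in_setT; apply/mem_vset/vertex_in.
have vsetf i : vset v (f i) = [set j | A i j].
  case: (HA) => _ _ hA; apply/setP => j; rewrite [RHS]inE.
  by apply/mem_vset/idP => /hA.
have aP : affdim P = d%:Z by case: PP.
split.
- by rewrite -{1}vset0 vset_closed //; apply: face0.
(* A facet containing all vertices would be [P], which has the wrong dimension. *)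
- apply/setP => i; rewrite in_set0; apply/negbTE/negP => /polarP h.
  have [fi di] := facet_face i; suff E : f i = P by move: di; rewrite E aP; lia.
  apply: vset_inj => //; first exact: faceT.
  by rewrite vsetf vsetT; apply/setP => j; rewrite !inE h.
- move=> j; have fj : faces P [set v j]%classic by case: (HA) => -[/(_ j Logic.I)].
  suff E : vset v [set v j]%classic = [set j] by rewrite -E vset_closed.
  apply/setP => l; rewrite [RHS]inE; apply/mem_vset/eqP => [|-> //] /=.
  by case: (HA) => -[_ inj _] _ _ => /(inj _ _ (mem_set Logic.I) (mem_set Logic.I)).
(* A facet without vertices would be empty, of dimension -1, contrary to [0 < d]. *)
- move=> d0 i; apply: contrapT => /forallNP h.
  have [fi di] := facet_face i; suff E : f i = classical_sets.set0 by move: di; rewrite E affdim0; lia.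
  apply: vset_inj => //; first exact: face0.
  by rewrite vsetf vset0; apply/setP => j; rewrite !inE; apply/negbTE/negP/h.
- move=> i i' h; case: (HA) => _ [_ inj _] _; apply: inj; [exact: mem_set|exact: mem_set|].
  apply: vset_inj; rewrite ?vsetf; [exact: (facet_face i).1|exact: (facet_face i').1|].
  by apply/setP => j; rewrite !inE h.
- by rewrite /rank_of -vset0 face_of_vset ?affdim0 //; apply: face0.
- by rewrite /rank_of -vsetT face_of_vset ?aP; [lia | apply: faceT].
(* Vertex sets turn inclusions of faces into inclusions of closed sets, so covers correspond to
   covers. *)
move=> X Y cX cY XY hZ.
suff : affdim (face_of Y) = affdim (face_of X) + 1 by rewrite !affdim_face_of; lia.
case: (PP) => /polyhedron_irredundant[q [M [b [E _]]]] bP _.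
have fX := face_of_face X; have fY := face_of_face Y.
rewrite E in bP; have := @affdim_face_cover R k q M b bP (face_of Y) (face_of X); rewrite -E; apply=> //.
- by apply: vset_subset => //; rewrite !vset_face_of cX cY proper_sub.
- by move/(congr1 (vset v)); rewrite !vset_face_of cX cY => XYE; move: XY; rewrite XYE properxx.
move=> F fF /vset_sub sXF /vset_sub sFY; rewrite !vset_face_of cX cY in sXF sFY.
case: (eqVneq X (vset v F)) => [->|XF]; first by left; rewrite face_of_vset.
right; have := hZ _ (vset_closed fF); rewrite !properEneq XF sXF sFY !andbT => /(_ isT).
by rewrite negbK => /eqP <-; rewrite face_of_vset.
Qed.

End FaceLattice.

(** * The face enumeration program *)

Lemma foldl_addn x s : foldl addn x s = x + sumn s.
Proof. by elim: s x => [|y s IH] x /=; rewrite ?addn0 // IH addnA. Qed.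

Lemma nth_offsets (ll : seq (seq nat)) f :
  f <= size ll -> nth 0 (offsets ll) f = sumn (take f (shape ll)).
Proof.
case: f => [|f] hf /=; first by rewrite take0.
by rewrite nth_scanl ?size_map // foldl_addn.
Qed.

Lemma nth_flatten_start (ll : seq (seq nat)) f i : f < size ll -> i < size (nth [::] ll f) ->
  nth 0 (flatten ll) (sumn (take f (shape ll)) + i) = nth 0 (nth [::] ll f) i.
Proof.
elim: ll f => // l ll IH [|f] /= hf hi; rewrite nth_cat; first by rewrite hi.
by rewrite -addnA ltnNge leq_addr /= addKn IH.
Qed.

Lemma input_rows m n (A : 'M[bool]_(m, n)) (inp : seq (seq nat)) a :
    ip inp 0 a = n -> ip inp 0 (1 - a) = m ->
    nth [::] inp (1 + a.*2) = offsets (row_lists A) ->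
    nth [::] inp (2 + a.*2) = flatten (row_lists A) -> input_side inp a A.
Proof.
move=> hn hm h1 h2; split=> // [f fm|f i fm hi]; rewrite /ip ?h1 ?h2.
  by rewrite nth_offsets ?size_row_lists.
by rewrite nth_flatten_start ?size_row_lists.
Qed.

Lemma input_side0 m n (A : 'M[bool]_(m, n)) : input_side (sparse A) 0 A.
Proof. exact: input_rows. Qed.

Lemma input_side1 m n (A : 'M[bool]_(m, n)) : input_side (sparse A) 1 A^T%R.
Proof. exact: input_rows. Qed.

Lemma incidences_tr m n (A : 'M[bool]_(m, n)) : incidences A^T%R = incidences A.
Proof.
rewrite /incidences exchange_big; apply: eq_bigr => i _; apply: eq_bigr => j _.
by rewrite mxE.
Qed.

Definition vertex_out :=
  Seq (For 5 (Cst 0) (eN 0) (SetArr 4 (Reg 5) (Arr 0 (Reg 5)))) (emit 0 (eN 0)).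

(** The number of descent steps is the size of the enumerated side: [m] here, [n] in [vertex_out].
    Both exceed [d], so they bound every rank, and the choice in [face_prog] makes the number min{n,
    m}. *)
Definition facet_out := Seq (polar_prog 1) (emit 0 (eN 1)).

Definition face_prog :=
  If (Op OLt (eN 1) (eN 0)) (enumeration 1 facet_out) (enumeration 0 vertex_out).

Section FaceProgram.
Variables (d n m : nat) (A : 'M[bool]_(m, n)) (rho : {set 'I_n} -> nat).
Hypothesis FL : face_lattice d A rho.

Let V := n + m + incidences A + 1.
Let U := work A.

Definition encode_face (X : {set 'I_n}) : seq nat :=
  rho X :: #|X| :: [seq val j | j <- enum X].

(** Arrays of length [n] suffice in both branches, since facets are enumerated only if [m < n]. All
    values stay below the input size [V]. *)
Lemma face_prog_tr : tr (sparse A) n V face_prog mem0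
    (10 + #|[set X | gclosure A X == X]| * (700 * ((minn n m + 1) * U)))
    (fun _ w => exists l, [/\ uniq l, forall X, X \in l = (gclosure A X == X)
       & w = flatten (map encode_face l)]).
Proof.
have hn := dim_lt_vertices FL; have hm := dim_lt_facets FL.
have nV : n <= V by rewrite /V; lia.
have mV : m <= V by rewrite /V; lia.
have aV : row_start A m <= V by rewrite row_start_incidences /V; lia.
have aV' : row_start A^T%R n <= V by rewrite row_start_incidences incidences_tr /V; lia.
have V0 : 0 < V by rewrite /V addn1.
have I0 := input_side0 A; have I1 := input_side1 A.
have UV : U = V by rewrite /U /work row_start_incidences.
have w1 : work A^T%R = U by rewrite UV /work row_start_incidences incidences_tr /V (addnC m n).
have okm := ok_mem0 n V.
have memZ x N : rep mem0 x (set0 : {set 'I_N}).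
  by move=> j; rewrite in_set0 /ar nth_nil nth_nil.
apply: (tr_if_le (T0 := 4 + #|[set X | gclosure A X == X]| * (700 * ((minn n m + 1) * U)))) => //.
have -> : (ev (sparse A) mem0 (Op OLt (eN 1) (eN 0)) != 0) = (m < n).
  by rewrite /= /ip /=; case: (m < n).
case: ltnP => mn.
(* No facet contains all vertices, so the facet enumeration may also start from the empty set. *)
- have c0 : gclosure A^T%R set0 = set0.
    rewrite /gclosure trmxK -[RHS](lattice_top FL); congr polar.
    by apply/setP => j; rewrite in_setT; apply/polarP => i; rewrite in_set0.
  have hout s' S : ok n V s' -> rep s' 0 S -> gclosure A^T%R S = S ->
      tr (sparse A) n V facet_out s' (60 * U + 280 * ((m + 1) * U))
        (fun _ w => w = encode_face (polar A^T%R S)).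
    move=> ok' rep0 cS; apply: (tr_seq_le (T1 := 60 * U) (T2 := 280 * ((m + 1) * U))).
    + rewrite -w1; apply: (tr_polar I1) => //; exact: rep0.
    + by [].
    move=> s1 w2 ok1 _ [-> h4] /=.
    have cG := gclosure_polar A S.
    apply: (tr_emit_face I0 nV mV aV ok1 (leqnn n) FL) => //.
    + by rewrite /V; lia.
    + have [h1 _] := rank_corank FL cG; exact: leq_trans h1 hm.
  have out0 : 0 \notin amods facet_out by [].
  have := tr_enumeration I1 mV nV aV' (ltnW mn) V0 out0 hout c0 okm (memZ 0 m).
  move=> h; apply: (tr_weaken h).
    rewrite card_closed_tr w1 leq_add2l leq_mul2l; apply/orP; right.
    have := leq_pmull U (isT : 0 < m.+1); rewrite -[m.+1]addn1.
    have : 0 < U by rewrite UV.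
    move: ((m + 1) * U) U => W U'; clear; lia.
  move=> _ w _ _ [l [ul hl ->]].
  have [ul' hl'] := polar_bij_closed ul hl.
  by exists (map (polar A^T%R) l); split=> //; rewrite -map_comp.
- have hout s' S : ok n V s' -> rep s' 0 S -> gclosure A S = S ->
      tr (sparse A) n V vertex_out s' (18 * (n + 1) + 280 * ((n + 1) * U))
        (fun _ w => w = encode_face S).
    move=> ok' rep0 cS.
    apply: (tr_seq_le (T1 := 18 * (n + 1)) (T2 := 280 * ((n + 1) * U))
      (Q1 := fun s' w => w = [::] /\ rep s' 4 S)) => //.
      apply: tr_weaken; first apply: (@tr_fill _ _ _ 4 _ _ _ n (fun v => ar s' 0 v)) => //.
      + by move=> v _; apply: ok_ar ok'.
      + by move=> v s2 vN fr /= r5 _; rewrite r5 fr.2.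
      + by rewrite /=; clear; lia.
      by move=> s2 w _ _ [-> h]; split=> // j; rewrite h.
    move=> s1 w2 ok1 _ [-> h4] /=.
    apply: (tr_emit_face I0 nV mV aV ok1 (leqnn n) FL) => //.
      by rewrite /V; clear; lia.
    have [h1 _] := rank_corank FL cS; exact: leq_trans h1 hn.
  have out0 : 0 \notin amods vertex_out by [].
  have := tr_enumeration I0 nV mV aV (leqnn n) V0 out0 hout (lattice_bot FL) okm (memZ 0 n).
  move=> h; apply: (tr_weaken h) => //.
  rewrite -/U leq_add2l leq_mul2l; apply/orP; right.
  have := leq_pmull U (isT : 0 < n.+1); rewrite -[n.+1]addn1.
  have : n + 1 <= (n + 1) * U by rewrite leq_pmulr // UV.
  have : 0 < U by rewrite UV.
  move: ((n + 1) * U) U => W U'; clear; lia.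
Qed.

End FaceProgram.

(** * From the program bounds to the asymptotic bounds *)

Section Arithmetic.
Variables (d n m : nat) (A : 'M[bool]_(m, n)) (rho : {set 'I_n} -> nat).
Hypothesis FL : face_lattice d A rho.
Local Notation alpha := (incidences A).

Lemma nbits_lt v k : 0 < k -> v < 2 ^ k -> nbits v <= k.
Proof.
rewrite /nbits => k0 vk; case: (posnP v) => [->|v0]; first by rewrite trunc_log0.
by rewrite -(@ltn_exp2l 2) // (leq_ltn_trans _ vk) // trunc_logP.
Qed.

Lemma incidences_le : alpha <= n * m.
Proof.
have : alpha <= \sum_(i < m) \sum_(j < n) 1.
  by apply: leq_sum => i _; apply: leq_sum => j _; apply: leq_b1.
by rewrite sum_nat_const sum1_card !card_ord mulnC => /leq_trans; apply.
Qed.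

Lemma facets_le_incidences : 0 < d -> m <= alpha.
Proof.
move=> d0; rewrite -[leqLHS]card_ord -sum1_card; apply: leq_sum => i _.
by have [j Aij] := facet_nonempty FL d0 i; rewrite (bigD1 j) //= Aij.
Qed.

Lemma vertices_le_incidences : 0 < d -> n <= alpha.
Proof.
move=> d0; rewrite /incidences exchange_big /= -[leqLHS]card_ord -sum1_card.
apply: leq_sum => j _.
by have [i Aij] := vertex_in_facet FL d0 j; rewrite (bigD1 i) //= Aij.
Qed.

Lemma size_small : n + m + alpha + 1 < 2 ^ (2 * n + 3).
Proof.
have n2 : n < 2 ^ n by apply: ltn_expl.
have m2 := facets_le_exp FL; have a2 := incidences_le.
have : 2 ^ (2 * n + 3) = 8 * (2 ^ n * 2 ^ n) by rewrite expnD mul2n -addnn expnD mulnC.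
move: (2 ^ n) n2 m2 => e n2 m2 ->; nia.
Qed.

Lemma space_small : space_bound n (n + m + alpha + 1) <= 95 * n ^ 2.
Proof.
have n0 : 0 < n by have := dim_lt_vertices FL; lia.
have : nbits (n + m + alpha + 1) <= 2 * n + 3.
  by apply: nbits_lt; [lia|exact: size_small].
rewrite /space_bound /num_regs /num_arrs => h.
(* The product is 12 * n^2 + 44 * n + 39, and 12 + 44 + 39 = 95. *)
apply: (@leq_trans ((13 + 6 * n) * (2 * n + 3))); first by rewrite leq_mul2l h orbT.
have : 0 < n * n by rewrite muln_gt0 n0.
rewrite -mulnn; nia.
Qed.

(** A quadratic number of bits is enough: for positive [d] the factors [d] and [trunc_log 2 n] are
    at least 1, and for [d = 0] there is a single vertex. *)
Lemma space_bounded C : 95 <= C ->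
  bounded_by C (n ^ 2 * d * trunc_log 2 n) (space_bound n (n + m + alpha + 1)).
Proof.
move=> hC; rewrite /bounded_by (leq_trans space_small) // leq_mul //.
have [d0|d0] := posnP d; first by rewrite (dim0_vertices FL d0) leq_max.
have n2 : 1 < n by apply: leq_ltn_trans (dim_lt_vertices FL).
have l0 : 0 < trunc_log 2 n by rewrite trunc_log_gt0.
by rewrite leq_max -mulnA leq_pmulr ?orbT // muln_gt0 d0.
Qed.

(** For positive [d] each of [n], [m] and 1 is at most [alpha], so the input size is at most
    [4 * alpha]. For [d = 0] everything is constant. *)
Lemma time_bounded C c phi : (200 * 100) <= C -> c <= phi -> 0 < c -> c <= 2 ^ n ->
  bounded_by C (minn n m * alpha * phi) (10 + c * (700 * ((minn n m + 1) * (n + m + alpha + 1)))).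
Proof.
move=> hC cphi c0 c2; have [d0|d0] := posnP d.
  have n1 := dim0_vertices FL d0; rewrite /bounded_by.
  have m2 := facets_le_exp FL; have a2 := incidences_le; move: (incidences A) a2 m2 c2 => al; rewrite n1 mul1n expn1 => a2 m2 c2.
  rewrite (leq_trans _ (leq_mul hC (leq_maxl 1 _))) // muln1.
  have k1 : minn 1 m <= 1 by rewrite geq_minl.
  (* Here [m] and [al] are at most 2, so the time is at most 10 + 2 * 700 * 12 = 16810. *)
  have h1 : (minn 1 m + 1) * (1 + m + al + 1) <= 2 * 6 by apply: leq_mul; lia.
  have := leq_mul c2 (leq_mul (leqnn 700) h1); lia.
have nm := facets_le_incidences d0; have nn := vertices_le_incidences d0.
have hn := dim_lt_vertices FL; have hm := dim_lt_facets FL.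
rewrite /bounded_by; set k := minn n m.
have k1 : 1 < k by rewrite leq_min; apply/andP; split; lia.
have a1 : 0 < alpha by lia.
have h1 : (k + 1) * (n + m + alpha + 1) <= (2 * k) * (4 * alpha) by apply: leq_mul; lia.
have p0 : 0 < k * alpha by rewrite muln_gt0 a1 (ltnW k1).
apply: (@leq_trans ((200 * 100) * (k * alpha * phi))); last by rewrite leq_mul // leq_maxr.
have h2 : c * (700 * ((k + 1) * (n + m + alpha + 1))) <= phi * (700 * (8 * (k * alpha))).
  by rewrite leq_mul // leq_mul // (leq_trans h1) //; lia.
have h3 : 0 < k * alpha * phi by rewrite muln_gt0 p0 (leq_trans c0).
move: h2 h3; rewrite (mulnC _ phi); move: (k * alpha) => W; nia.
Qed.

Lemma all_offsets (B : nat) ll : sumn (shape ll) <= B -> all (leq^~ B) (offsets ll).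
Proof.
move=> h; apply/(all_nthP 0) => i hi; rewrite nth_offsets.
  by rewrite -[shape ll](cat_take_drop i) sumn_cat in h; apply: leq_trans h; apply: leq_addr.
by move: hi; rewrite /= size_scanl size_map.
Qed.

Lemma all_flatten_rows p q (B : 'M[bool]_(p, q)) : all (leq^~ q) (flatten (row_lists B)).
Proof.
apply/allP => x /flattenP[s /mapP[i _ ->] /mapP[j _ ->]]; exact/ltnW/ltn_ord.
Qed.

Lemma size_flatten_rows p q (B : 'M[bool]_(p, q)) : size (flatten (row_lists B)) = incidences B.
Proof.
rewrite size_flatten -row_start_incidences /row_start take_oversize //.
by rewrite size_map size_row_lists.
Qed.

Lemma input_bounded C : 100 <= C ->
  bounded_by C (alpha * trunc_log 2 (maxn n m)) (bits2 (sparse A)).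
Proof.
move=> hC; pose V := n + m + alpha + 1.
have s1 : sumn (shape (row_lists A)) = alpha by rewrite -size_flatten size_flatten_rows.
have s2 : sumn (shape (row_lists A^T%R)) = alpha.
  by rewrite -size_flatten size_flatten_rows incidences_tr.
have le W l : W <= V -> all (leq^~ W) l -> bits l <= size l * nbits V.
  by move=> WV /bits_leq h; apply: leq_trans h _; rewrite leq_mul // nbits_leq.
have hb : bits2 (sparse A) <= (n + m + 2 * alpha + 4) * nbits V.
  rewrite /bits2 /sparse !big_cons big_nil addn0.
  have h1 := @le V [:: n; m] (leqnn _).
  have h2 := @le alpha (offsets (row_lists A)).
  have h3 := @le n (flatten (row_lists A)).
  have h4 := @le alpha (offsets (row_lists A^T%R)).
  have h5 := @le m (flatten (row_lists A^T%R)).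
  rewrite !size_flatten_rows incidences_tr in h3 h5.
  rewrite /= !(size_scanl, size_map, size_row_lists) in h1 h2 h4.
  have {}h1 : bits [:: n; m] <= 2 * nbits V by apply: h1; rewrite /V; apply/and3P; split=> //; lia.
  have {}h2 : bits (offsets (row_lists A)) <= m.+1 * nbits V.
    by apply: h2; [rewrite /V; lia|apply: all_offsets; rewrite s1].
  have {}h3 : bits (flatten (row_lists A)) <= alpha * nbits V.
    by apply: h3; [rewrite /V; lia|apply: all_flatten_rows].
  have {}h4 : bits (offsets (row_lists A^T%R)) <= n.+1 * nbits V.
    by apply: h4; [rewrite /V; lia|apply: all_offsets; rewrite s2].
  have {}h5 : bits (flatten (row_lists A^T%R)) <= alpha * nbits V.
    by apply: h5; [rewrite /V; lia|apply: all_flatten_rows].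
  move: (nbits V) h1 h2 h3 h4 h5 => z; clear; lia.
rewrite /bounded_by (leq_trans hb) //; have [d0|d0] := posnP d.
  have n1 := dim0_vertices FL d0.
  have m2 := facets_le_exp FL; have a2 := incidences_le.
  have {}m2 : m <= 2 by move: m2; rewrite n1.
  have nm1 : n * m = m by rewrite n1 mul1n.
  have {}a2 : alpha <= m by rewrite -{2}nm1.
  have : nbits V <= 3 by apply: nbits_lt => //; rewrite /V -[2 ^ 3]/8; lia.
  have h : n + m + 2 * alpha + 4 <= 11 by lia.
  move=> h'; rewrite (leq_trans (leq_mul h h')) // (leq_trans _ (leq_mul hC (leq_maxl 1 _))) //.
have nm := facets_le_incidences d0; have nn := vertices_le_incidences d0.
have hn := dim_lt_vertices FL.
set mu := maxn n m; set t := trunc_log 2 mu.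
have mu2 : 1 < mu by rewrite leq_max; apply/orP; left; lia.
have t0 : 0 < t by rewrite /t trunc_log_gt0.
have mut : mu < 2 ^ t.+1 by apply: trunc_log_ltn.
have nmu : n <= mu by apply: leq_maxl.
have mmu : m <= mu by apply: leq_maxr.
have Vt : nbits V <= 2 * t + 4.
  apply: nbits_lt; first by lia.
  have -> : 2 ^ (2 * t + 4) = 4 * (2 ^ t.+1 * 2 ^ t.+1).
    by rewrite -expnD (_ : 4 = 2 ^ 2) // -expnD; congr (2 ^ _); lia.
  have := incidences_le; have := leq_mul nmu mmu; rewrite /V.
  move: (2 ^ t.+1) mut => e mut h1 h2; nia.
(* There are at most [8 * alpha] stored numbers, as [n], [m] and 1 are at most [alpha]. Each has at
   most [2 * t + 4 <= 6 * t] bits. *)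
apply: (@leq_trans (8 * alpha * (6 * t))); first by apply: leq_mul; lia.
apply: (@leq_trans (100 * (alpha * t))); first by rewrite mulnACA leq_mul.
by rewrite leq_mul // leq_maxr.
Qed.

End Arithmetic.

(** * From the list of closed sets to the list of faces *)

Section Enumeration.
Local Open Scope ring_scope.
Variables (R : realType) (k d : nat) (P : set 'rV[R]_k) (n m : nat).
Variables (v : 'I_n -> 'rV[R]_k) (f : 'I_m -> set 'rV[R]_k) (A : 'M[bool]_(m, n)).
Hypotheses (PP : polytope d P) (HA : vf_incidence d P v f A).
Variable l : seq {set 'I_n}.
Hypotheses (ul : uniq l) (hl : forall X, X \in l = (gclosure A X == X)).

Local Notation rho := (rank_of P f A).
Local Notation Gs := [seq face_of P f A X | X <- l].

Lemma faces_list : uniq Gs /\ forall G, G \in Gs <-> faces P G.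
Proof.
split.
  rewrite map_inj_in_uniq // => X Y; rewrite !hl => /eqP cX /eqP cY E.
  by rewrite -cX -cY -!(vset_face_of HA) E.
move=> G; split=> [/mapP[X _ ->]|fG]; first exact: (face_of_face HA).
apply/mapP; exists (vset v G); first by rewrite hl (vset_closed PP HA).
by rewrite (face_of_vset PP HA).
Qed.

Lemma enumerates_closed : enumerates P v [seq (X, (rho X)%:Z - 1) | X <- l].
Proof.
have [uG hG] := faces_list; exists Gs; split=> //; rewrite -map_comp.
apply/eq_in_map => X; rewrite hl => /eqP cX /=.
by rewrite (vset_face_of HA) cX (affdim_face_of PP HA).
Qed.

Lemma encode_closed :
  encode [seq (X, (rho X)%:Z - 1) | X <- l] = flatten (map (encode_face rho) l).
Proof.
rewrite /encode -map_comp; congr flatten; apply: eq_map => X /=.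
by rewrite subrK.
Qed.

Lemma card_faces phi : (faces P #= `I_phi)%card ->
  #|[set X | gclosure A X == X]%SET| = phi.
Proof.
have [uG hG] := faces_list => hphi.
have -> : #|[set X | gclosure A X == X]%SET| = size Gs.
  by rewrite size_map -(card_uniqP ul); apply: eq_card => X; rewrite hl inE.
have E : faces P = [set` [fset G in Gs]%fset]%classic.
  apply/seteqP; split=> G /=; first by move/hG => GG; rewrite in_fset.
  by rewrite in_fset => /hG.
move: hphi; rewrite E => /card_eq_fsetP <-.
by rewrite card_fseq undup_id.
Qed.

End Enumeration.

Theorem mainTheorem4 :
  exists (prog1 prog2 : prog) (C : nat),
  forall (R : realType) (k d : nat) (P : set 'rV[R]_k)
    (n m : nat) (v : 'I_n -> 'rV[R]_k) (f : 'I_m -> set 'rV[R]_k)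
    (A : 'M[bool]_(m, n)) (phi : nat),
  polytope d P ->
  vf_incidence d P v f A ->
  (faces P #= `I_phi)%card ->
  let alpha := incidences A in
  (* part (1) *)
  [/\ bounded_by C (alpha * trunc_log 2 (maxn n m)) (bits2 (sparse A))
    & exists (L : seq ({set 'I_n} * int)) (t b : nat),
        [/\ runs prog1 (sparse A) t b (encode L),
            enumerates P v L,
            bounded_by C (n * alpha * phi) t
          & bounded_by C (n ^ 2 * d * trunc_log 2 n) b]]
  /\
  (* part (2) *)
  exists (L : seq ({set 'I_n} * int)) (t b : nat),
    [/\ runs prog2 (sparse A) t b (encode L),
        enumerates P v L,
        bounded_by C (minn n m * alpha * phi) t
      & (* L is obtained by applying prog1 to P or to the dual polytope *)
        (exists t1 b1 : nat, runs prog1 (sparse A) t1 b1 (encode L)) \/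
        (exists (L' : seq ({set 'I_m} * int)) (t1 b1 : nat),
           runs prog1 (sparse (A^T)%R) t1 b1 (encode L') /\
           L = [seq dual_face A d p | p <- L'])].
Proof.
(* One program serves both parts, and 200 * 100 exceeds the constants of the time, space and input
   bounds. *)
exists face_prog, face_prog, (200 * 100) => R k d P n m v f A phi PP HA hphi alpha.
have FL := polytope_face_lattice PP HA.
have [s [t [b [w [hex + hb _ [l [ul hl Ew]]]]]]] := face_prog_tr FL.
rewrite /work row_start_incidences => ht.
have cphi := card_faces PP HA ul hl hphi.
have enc := encode_closed P f A l.
have hrun : runs face_prog (sparse A) t b (encode [seq (X, (rank_of P f A X)%:Z - 1)%R | X <- l]).
  by exists s; rewrite enc -Ew.
have henum := enumerates_closed PP HA ul hl.
have htime : bounded_by (200 * 100) (minn n m * alpha * phi) t.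
  apply: (leq_trans ht); apply: (time_bounded FL) => //.
  - by rewrite cphi.
  - by apply/card_gt0P; exists set0; rewrite inE (lattice_bot FL).
  - by rewrite (leq_trans (max_card _)) // -cardsT -powersetT card_powerset cardsT card_ord.
(* As both programs coincide, the run of the second is also a run of the first on [P]; the choice
   between the two sides is made inside the program. *)
split; [split|]; last by exists [seq (X, (rank_of P f A X)%:Z - 1)%R | X <- l], t, b; split=> //; left; exists t, b.
  exact: (input_bounded FL).
exists [seq (X, (rank_of P f A X)%:Z - 1)%R | X <- l], t, b; split=> //.
  apply: leq_trans htime _; rewrite leq_mul2l; apply/orP; right.
  by rewrite geq_max leq_maxl leq_max /= !leq_mul ?geq_minl ?orbT.
by apply: (leq_trans hb); apply: (space_bounded FL).
Qed.
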